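(* Let $\Omega\subset\mathbb{R}^d$ be a bounded open convex set. Let $\varphi:\bar\Omega\to\mathbb{R}$ be continuous, and locally affine a.e. in $\Omega$. For $t>0$ let $\psi_t(z)=\frac12|z|^2+t\varphi(z)$ for $z\in\bar\Omega$ and $\psi_t(z)=+\infty$ for $z\in\mathbb{R}^d\setminus\bar\Omega$, and let $\psi_t^{**}$ be its convexification. Then $\varphi$ is convex if and only if for some $t>0$ the push-forward of Lebesgue measure under the (a.e.-defined) gradient of $\psi_t^{**}$, $$\kappa_t=(\nabla\psi_t^{**})_\sharp\lambda,$$ is absolutely continuous with respect to Lebesgue measure $\lambda$ on $\mathbb{R}^d$.
   Context: $\lambda$ denotes Lebesgue measure on $\mathbb{R}^d$. A function is locally affine a.e. in $\Omega$ if, for Lebesgue-a.e. $x\in\Omega$, it is affine on some neighborhood of $x$. $f^*(x)=\sup_{z\in\mathbb{R}^d}(x\cdot z-f(z))$ is the Legendre transform, and the convexification of $f$ is $f^{**}=(f^* )^*$. The function $\psi_t^{**}$ is finite exactly on $\bar\Omega$ and differentiable a.e. there; thus for Borel $B\subset\mathbb{R}^d$, $\kappa_t(B)=\lambda(\{y:\psi_t^{**}\text{ is differentiable at }y\text{ and }\nabla\psi_t^{**}(y)\in B\})$. *)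

(* Defs.v *)
From HB Require Import structures.
From mathcomp Require Import all_boot all_order all_algebra.
From mathcomp Require Import all_classical all_reals all_analysis.
Set Implicit Arguments.
Unset Strict Implicit.
Unset Printing Implicit Defensive.
Import Order.TTheory GRing.Theory Num.Theory.
Import numFieldNormedType.Exports.
Local Open Scope classical_set_scope.
Local Open Scope ring_scope.

Definition box (R : realType) (d : nat) (a b : 'rV[R]_d) : set 'rV[R]_d :=
  [set x | forall i, a 0 i < x 0 i <= b 0 i].

Definition box_volume (R : realType) (d : nat) (a b : 'rV[R]_d) : R :=
  \prod_(i < d) (b 0 i - a 0 i).

(* [D] is there because for [d = 0] no box is empty, so that a finite cover
   cannot be padded into a sequence of boxes of the same total volume. *)
Definition box_cover (R : realType) (d : nat) (A : set 'rV[R]_d)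
    (D : set nat) (a b : nat -> 'rV[R]_d) : Prop :=
  (forall k, D k -> forall i, a k 0 i <= b k 0 i) /\
  A `<=` \bigcup_(k in D) box (a k) (b k).

Definition lebesgue_outer (R : realType) (d : nat) (A : set 'rV[R]_d) : \bar R :=
  ereal_inf [set s | exists D a b, box_cover A D a b /\
    s = (\esum_(k in D) (box_volume (a k) (b k))%:E)%E].

Section lebesgue_outer_measure.
Variables (R : realType) (d : nat).
Local Open Scope ereal_scope.
Local Notation mu := (@lebesgue_outer R d).

Lemma box_cover_volume_ge0 A D (a b : nat -> 'rV[R]_d) : box_cover A D a b ->
  forall k, D k -> 0 <= (box_volume (a k) (b k))%:E.
Proof.
by move=> [ab _] k Dk; rewrite lee_fin; apply: prodr_ge0 => i _;
  rewrite subr_ge0 ab.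
Qed.

Lemma lebesgue_outer_ge0 A : 0 <= mu A.
Proof.
apply: le_ereal_inf_tmp => _ [D [a [b [cA ->]]]].
exact/esum_ge0/(box_cover_volume_ge0 cA).
Qed.

Lemma lebesgue_outer0 : mu set0 = 0.
Proof.
apply/eqP; rewrite eq_le lebesgue_outer_ge0 andbT.
apply: ereal_inf_lbound; exists set0, (fun=> 0%R), (fun=> 0%R).
by rewrite esum_set0; split=> //; split.
Qed.

Lemma le_lebesgue_outer : {homo mu : A B / A `<=` B >-> A <= B}.
Proof.
move=> A B AB; apply/ereal_inf_le_tmp => _ [D [a [b [[ab Bc] ->]]]].
by exists D, a, b; split=> //; split=> //; exact: subset_trans Bc.
Qed.

Lemma lebesgue_outer_cover A (e : R) : mu A < +oo -> (0 < e)%R ->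
  exists D a b, box_cover A D a b /\
    \esum_(k in D) (box_volume (a k) (b k))%:E <= mu A + e%:E.
Proof.
move=> Aoo e0; have fA : mu A \is a fin_num.
  by rewrite ge0_fin_numE// lebesgue_outer_ge0.
have [_ [D [a [b [cA ->]]]] le] := lb_ereal_inf_adherent e0 fA.
by exists D, a, b; split=> //; exact: ltW.
Qed.

Lemma lebesgue_outer_sigma_subadditive : sigma_subadditive mu.
Proof.
move=> A; have [[i ioo]|] := pselect (exists i, mu (A i) = +oo).
  rewrite (eseries_pinfty _ _ ioo) ?leey// => n _.
  by rewrite -ltNye (lt_le_trans _ (lebesgue_outer_ge0 _)).
rewrite -forallNE => Aoo; apply/lee_addgt0Pr => e e0.
rewrite (le_trans _ (epsilon_trick _ _ (ltW e0)))//; last first.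
  by move=> n; exact: lebesgue_outer_ge0.
have /choice[D /choice[a /choice[b Dab]]] n : exists D a b,
    box_cover (A n) D a b /\ \esum_(k in D) (box_volume (a k) (b k))%:E <=
      mu (A n) + (e / (2 ^ n.+1)%:R)%:E.
  by apply: lebesgue_outer_cover; [rewrite ltey; exact/eqP|rewrite divr_gt0].
have /card_esym/ppcard_eqP[f] := card_nat2.
pose v (p : nat * nat) : \bar R := (box_volume (a p.1 p.2) (b p.1 p.2))%:E.
pose E := [set p : nat * nat | D p.1 p.2].
have v0 p : E p -> 0 <= v p by exact: (box_cover_volume_ge0 (Dab p.1).1).
apply: (@le_trans _ _ (\esum_(p in E) v p)).
  apply: ereal_inf_lbound.
  exists (f @^-1` E), (fun k => a (f k).1 (f k).2), (fun k => b (f k).1 (f k).2).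
  split; first split.
  - by move=> k Ek; exact: (Dab (f k).1).1.1.
  - move=> x [n _ /((Dab n).1.2)[k Dk xk]].
    by exists (f^-1%FUN (n, k)); rewrite /= invK ?inE.
  - rewrite (reindex_esum (f @^-1` E) E f)//; split.
    + by move=> k.
    + by move=> k l _ _; apply: (@inj _ _ setT f); rewrite inE.
    + by move=> p Ep; exists (f^-1%FUN p); rewrite /= invK ?inE.
have -> : E = setT `*`` D by apply/seteqP; split=> [[n k] ?|[n k] []].
rewrite -(@esum_esum _ _ _ setT D (fun n k => v (n, k)))/=; last first.
  by move=> n k _ Dk; exact: v0.
have s0 n : 0 <= \esum_(k in D n) v (n, k).
  by apply: esum_ge0 => k Dk; exact: v0.
rewrite -nneseries_esumT//.
by apply: lee_nneseries => // n _; exact: (Dab n).2.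
Qed.

HB.instance Definition _ := isOuterMeasure.Build R 'rV[R]_d mu
  lebesgue_outer0 lebesgue_outer_ge0 le_lebesgue_outer
  lebesgue_outer_sigma_subadditive.

End lebesgue_outer_measure.

Section borel_sets_are_caratheodory.
Variables (R : realType) (d : nat).
Local Open Scope ereal_scope.
Local Notation mu := (@lebesgue_outer R d).
Let upd (v : 'rV[R]_d) (i : 'I_d) (r : R) : 'rV[R]_d :=
  (\row_j if j == i then r else v 0%R j)%R.

Let box_volume_split (a b : 'rV[R]_d) i m :
  (box_volume a (upd b i m) + box_volume (upd a i m) b = box_volume a b)%R.
Proof.
have E u v : box_volume u v =
    ((v 0 i - u 0 i) * \prod_(j < d | j != i) (v 0 j - u 0 j))%R.
  by rewrite /box_volume (bigD1 i).
rewrite !E !mxE eqxx.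
under eq_bigr => j /negbTE ji do rewrite mxE ji.
under [X in (_ + _ * X)%R]eq_bigr => j /negbTE ji do rewrite mxE ji.
by rewrite -mulrDl addrC addrA subrK.
Qed.

Let halfspace_caratheodory (i : 'I_d) (c : R) :
  mu.-caratheodory [set x : 'rV[R]_d | (x 0 i <= c)%R].
Proof.
apply: le_caratheodory_measurable => X.
set H := [set x | _]; change (mu (X `&` H) + mu (X `&` ~` H) <= mu X).
have [->|] := eqVneq (mu X) +oo; first by rewrite leey.
rewrite -ltey => Xoo; apply/lee_addgt0Pr => e e0.
have [D [a [b [cX le]]]] := lebesgue_outer_cover Xoo e0.
apply: (le_trans _ le); have [ab Xab] := cX.
pose m k := Num.max (a k 0%R i) (Num.min (b k 0%R i) c).
have am k : (a k 0 i <= m k)%R by rewrite le_max lexx.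
have mb k : D k -> (m k <= b k 0 i)%R.
  by move=> Dk; rewrite ge_max ab//= ge_min lexx.
have cv1 : box_cover (X `&` H) D
    a (fun k => upd (b k) i (m k)).
  split=> [k Dk j|x [/Xab[k Dk xk] /= xc]].
    by rewrite mxE; case: eqP => [->|_]; [exact: am|exact: ab].
  exists k => // j; rewrite mxE; case: eqP => [->|_]; last exact: xk.
  have /andP[-> xb] := xk i.
  by rewrite /m le_max le_min xb xc orbT.
have cv2 : box_cover (X `&` ~` H) D
    (fun k => upd (a k) i (m k)) b.
  split=> [k Dk j|x [/Xab[k Dk xk] /= xc]].
    by rewrite mxE; case: eqP => [->|_]; [exact: mb|exact: ab].
  exists k => // j; rewrite mxE; case: eqP => [->|_]; last exact: xk.
  have /andP[ax ->] := xk i; rewrite andbT /m gt_max ax gt_min.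
  by move/negP: xc; rewrite -ltNge => ->; rewrite orbT.
rewrite (@eq_esum _ _ D _ (fun k => (box_volume (a k) (upd (b k) i (m k)))%:E +
    (box_volume (upd (a k) i (m k)) (b k))%:E)); last first.
  by move=> k _; rewrite -EFinD box_volume_split.
rewrite esumD; [|exact: (box_cover_volume_ge0 cv1)|
                 exact: (box_cover_volume_ge0 cv2)].
apply: leeD; apply: ereal_inf_lbound.
  by exists D, a, (fun k => upd (b k) i (m k)).
by exists D, (fun k => upd (a k) i (m k)), b.
Qed.

Local Notation U := (caratheodory_type mu).

Let measurable_box (a b : 'rV[R]_d) : measurable (box a b : set U).
Proof.
rewrite (_ : box a b = \bigcap_(i in [set: 'I_d])
    ([set x : 'rV[R]_d | (x 0 i <= b 0 i)%R] `\`
     [set x : 'rV[R]_d | (x 0 i <= a 0 i)%R])); last first.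
  apply/seteqP; split=> [x xab i _ /=|x xab i].
    by have /andP[ax ->] := xab i; split=> //; apply/negP; rewrite -ltNge.
  by have [/= -> /negP] := xab i I; rewrite -ltNge => ->.
apply: fin_bigcap_measurable => // i _.
by apply: measurableD; exact: halfspace_caratheodory.
Qed.

Lemma open_lebesgue_caratheodory (A : set 'rV[R]_d) :
  open A -> mu.-caratheodory A.
Proof.
move=> oA; pose q (p : 'rV[rat]_d) : 'rV[R]_d := (map_mx ratr p)%R.
pose F (p : 'rV[rat]_d * 'rV[rat]_d) : set 'rV[R]_d :=
  box (q p.1) (q p.2) `&` [set x | box (q p.1) (q p.2) `<=` A].
have -> : A = \bigcup_p F p.
  apply/seteqP; split=> [x Ax|x [p _ [xp pA]]]; last exact: pA.
  have /nbhs_ballP[e /= e0 xeA] : nbhs x A by exact: open_nbhs_nbhs.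
  have /choice[l lP] i : exists r : rat, ratr r \in `](x 0 i - e)%R, x 0%R i[.
    by apply: rat_in_itvoo; rewrite ltrBlDr ltrDl.
  have /choice[u uP] i : exists r : rat, ratr r \in `]x 0%R i, (x 0 i + e)%R[.
    by apply: rat_in_itvoo; rewrite ltrDl.
  exists ((\row_i l i)%R, (\row_i u i)%R) => //; split=> [i|y yb].
    rewrite !mxE /=; have := lP i; have := uP i.
    by rewrite !in_itv/= => /andP[/ltW -> _] /andP[_ ->].
  apply: xeA; split=> // i j; rewrite ord1 {i} -ball_normE /=.
  have := yb j; have := lP j; have := uP j.
  rewrite !mxE !in_itv/= => /andP[xu ux] /andP[xl lx] /andP[ly yu].
  rewrite distrC ltr_distl; apply/andP; split.
    exact: lt_trans xl ly.
  exact: le_lt_trans yu ux.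
apply: (@countable_bigcupT_measurable _ U) => // p.
have [pA|pA] := pselect (box (q p.1) (q p.2) `<=` A).
  rewrite (_ : F p = box (q p.1) (q p.2)); first exact: measurable_box.
  by apply/seteqP; split=> [x []|x].
rewrite (_ : F p = set0); first exact: measurable0.
by apply/seteqP; split=> [x []|x].
Qed.

Lemma borel_lebesgue_caratheodory (A : set 'rV[R]_d) :
  <<s open >> A -> mu.-caratheodory A.
Proof.
apply: smallest_sub; last exact: open_lebesgue_caratheodory.
exact: (sigma_algebra_measurable U).
Qed.
End borel_sets_are_caratheodory.

Notation borel_rV R d := (g_sigma_algebraType (@open 'rV[R]_d)).

Definition lebesgue_rV (R : realType) (d : nat) :
  set (borel_rV R d) -> \bar R := @lebesgue_outer R d.

Section lebesgue_rV_measure.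
Variables (R : realType) (d : nat).

Let lebesgue_rV_semi_sigma_additive :
  semi_sigma_additive (@lebesgue_rV R d).
Proof.
move=> F mF tF mUF.
apply: (@caratheodory_measure_sigma_additive _ _ (@lebesgue_outer R d)) => //.
- by move=> i; exact: borel_lebesgue_caratheodory (mF i).
- exact: borel_lebesgue_caratheodory mUF.
Qed.

HB.instance Definition _ := isMeasure.Build _ (borel_rV R d) R
  (@lebesgue_rV R d) (@lebesgue_outer0 R d) (@lebesgue_outer_ge0 R d)
  lebesgue_rV_semi_sigma_additive.

End lebesgue_rV_measure.

Definition dot (R : realType) (d : nat) (u v : 'rV[R]_d) : R :=
  \sum_(i < d) u 0 i * v 0 i.

(* The norm of ['rV[R]_d] in the library is the sup norm, hence [dot]. *)
Definition sqnorm (R : realType) (d : nat) (z : 'rV[R]_d) : R := dot z z.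

Definition locally_affine_at (R : realType) (d : nat) (f : 'rV[R]_d -> R)
    (x : 'rV[R]_d) : Prop :=
  exists (p : 'rV[R]_d) (c : R), \forall y \near x, f y = dot p y + c.

Definition legendre (R : realType) (d : nat) (f : 'rV[R]_d -> \bar R)
    (x : 'rV[R]_d) : \bar R :=
  ereal_sup (range (fun z => ((dot x z)%:E - f z)%E)).

Definition convexification (R : realType) (d : nat)
    (f : 'rV[R]_d -> \bar R) : 'rV[R]_d -> \bar R :=
  legendre (legendre f).

(* [fine] sends the infinities to 0, hence the explicit finiteness condition. *)
Definition ediffble (R : realType) (d : nat) (f : 'rV[R]_d -> \bar R)
    (y : 'rV[R]_d) : Prop :=
  (\forall x \near y, f x \is a fin_num) /\
  differentiable (fine \o f : 'rV[R]_d -> R^o) y.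

Definition egradient (R : realType) (d : nat) (f : 'rV[R]_d -> \bar R)
    (y : 'rV[R]_d) : 'rV[R]_d :=
  \row_i 'D_(delta_mx 0 i) (fine \o f : 'rV[R]_d -> R^o) y.

Definition gradient_pushforward (R : realType) (d : nat)
    (f : 'rV[R]_d -> \bar R) (B : set (borel_rV R d)) : \bar R :=
  lebesgue_rV [set y | ediffble f y /\ B (egradient f y)].

(* The values of [phi] outside [closure Omega] are never used. *)
Definition psi (R : realType) (d : nat) (Omega : set 'rV[R]_d)
    (phi : 'rV[R]_d -> R) (t : R) (z : 'rV[R]_d) : \bar R :=
  if z \in closure Omega then (2^-1 * sqnorm z + t * phi z)%:E else +oo%E.

Definition kappa (R : realType) (d : nat) (Omega : set 'rV[R]_d)
    (phi : 'rV[R]_d -> R) (t : R) : set (borel_rV R d) -> \bar R :=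
  gradient_pushforward (convexification (psi Omega phi t)).

(* Main.v *)
Require Import Defs.
From HB Require Import structures.
From mathcomp Require Import all_boot all_order all_algebra.
From mathcomp Require Import all_classical all_reals all_analysis.
From mathcomp Require Import measurable_realfun ring lra.
Import Order.TTheory GRing.Theory Num.Theory.
Import numFieldNormedType.Exports.
Set Implicit Arguments.
Unset Strict Implicit.
Unset Printing Implicit Defensive.
Local Open Scope classical_set_scope.
Local Open Scope ring_scope.

(** Write [psi] for [psi Omega phi t] and [F] for its Legendre transform, a maximum of
    affine functions over the compact set [closure Omega].

    If [phi] is convex, a point [y] near which [phi] is affine with slope [p] satisfies
    [psi z >= psi y + (y + t p).(z - y)] for all [z], so [psi^** = psi] near [y] and the
    gradient there is [y + t p]: locally a translation, under which preimages of null
    sets are null. Off [closure Omega] the convexification is infinite.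

    Conversely, suppose [kappa << lambda]. If [psi^** < psi] at [y] and [psi^**] has
    gradient [p] at [y], then [F] has two distinct subgradients at [p]: [y] itself and
    a maximizer of [p.z - psi z]. The set of points where a continuous function has two
    subgradients is null, since it is covered by countably many closed sets having
    infinitely many disjoint translates along an axis. So absolute continuity makes
    the open set [psi^** < psi] null (near one of its points [psi^**] is again a
    maximum of affine functions over a compact set, hence differentiable a.e. by the
    same argument), hence empty. Thus [psi] is convex and the second differences of
    [phi] satisfy [phi (z + v) + phi (z - v) - 2 phi z >= - |v|^2 / t]. Averaging [phi]
    over small translations and applying Fatou's lemma to the difference quotients,
    which vanish eventually at almost every point, the average has second derivative at
    least 0 in the generalized sense, so it is convex along segments; shrinking
    the translations yields the convexity of [phi]. *)

(** * Lebesgue measure on row vectors *)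

Section box_lower_bound.
Variables (R : realType) (d : nat).
Implicit Types (a b x : 'rV[R]_d).

Definition row_set x (i : 'I_d) (r : R) : 'rV[R]_d :=
  \row_j if j == i then r else x 0 j.

(** The indicator of the box with the coordinates of index at least [j] integrated out; it passes
    from [box_volume] at [j = 0] to the indicator of the box at [j = d]. *)
Definition partial_volume a b (j : nat) x : R :=
  \prod_(i < d) if (i < j)%N then \1_(`]a 0 i, b 0 i]) (x 0 i)
                else b 0 i - a 0 i.

Lemma partial_volume_ge0 a b j x : (forall i, a 0 i <= b 0 i) ->
  0 <= partial_volume a b j x.
Proof.
by move=> ab; apply: prodr_ge0 => i _; case: ifP => _ //; rewrite subr_ge0.
Qed.

Lemma partial_volume0 a b x : partial_volume a b 0 x = box_volume a b.
Proof. by []. Qed.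

Lemma partial_volume_full a b x : partial_volume a b d x = \1_(box a b) x.
Proof.
rewrite /partial_volume; under eq_bigr => i _ do rewrite ltn_ord.
have [xab|xab] := pselect (box a b x).
  rewrite [RHS]indicE mem_set//= big1// => i _.
  by rewrite indicE mem_set//= in_itv/=; exact: xab.
rewrite [RHS]indicE memNset//=.
have [i /negP xi] : exists i, ~ (a 0 i < x 0 i <= b 0 i).
  by apply/existsNP => h; apply: xab.
rewrite (bigD1 i)//= indicE memNset ?mul0r//= in_itv/=.
exact/negP.
Qed.

Lemma integral_partial_volume a b (i : 'I_d) x : (forall i, a 0 i <= b 0 i) ->
  (\int[lebesgue_measure]_r (partial_volume a b i.+1 (row_set x i r))%:E =
  (partial_volume a b i x)%:E)%E.
Proof.
move=> ab; pose c := \prod_(j < d | j != i)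
  if (j < i)%N then \1_(`]a 0 j, b 0 j]) (x 0 j) else b 0 j - a 0 j.
have c0 : 0 <= c.
  by apply: prodr_ge0 => j _; case: ifP => _ //; rewrite subr_ge0.
have E r : partial_volume a b i.+1 (row_set x i r) =
    c * \1_(`]a 0 i, b 0 i]) r.
  rewrite /partial_volume (bigD1 i)//= ltnSn mxE eqxx mulrC; congr (_ * _).
  apply: eq_bigr => j ji; rewrite mxE (negbTE ji) ltnS leq_eqVlt.
  by rewrite -[X in X || _]/(j == i) (negbTE ji).
under eq_integral => r _ do rewrite E EFinM.
rewrite ge0_integralZl//; last first.
  by apply/measurable_EFinP; exact: measurable_indic.
rewrite integral_indic//= setIT. rewrite lebesgue_measure_itv/= lte_fin.
rewrite /partial_volume (bigD1 i)//= ltnn mulrC EFinM -/c.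
have := ab i; rewrite le_eqVlt => /predU1P[->|->]; last by rewrite EFinB.
by rewrite ltxx subrr.
Qed.

Lemma measurable_partial_volume a b (i : 'I_d) x :
  measurable_fun setT (fun r => (partial_volume a b i.+1 (row_set x i r))%:E).
Proof.
apply/measurable_EFinP; apply: measurable_prod => j _.
case: (j < i.+1)%N => //.
rewrite (_ : (fun _ => _) = fun r => \1_(`]a 0 j, b 0 j]) (if j == i then r else x 0 j)).
  by case: (j == i) => //; exact: measurable_indic.
by apply/funext => r; rewrite mxE.
Qed.

(* Integrating [1_box <= \sum_k 1_(box_k)] one coordinate at a time turns the
   indicators into side lengths. *)
Lemma box_volume_le_outer a b : (forall i, a 0 i <= b 0 i) ->
  ((box_volume a b)%:E <= lebesgue_outer (box a b))%E.
Proof.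
move=> ab; apply: le_ereal_inf_tmp => _ [D [ak [bk [[akbk cov] ->]]]].
(* The value 0 outside [D] turns the sum over [D] into a series over [nat]. *)
pose F j x k := if k \in D then (partial_volume (ak k) (bk k) j x)%:E else 0%E.
have F0 j x k : (0 <= F j x k)%E.
  rewrite /F; case: ifPn => // /set_mem kD.
  by rewrite lee_fin partial_volume_ge0//; exact: akbk.
(* Here [n] counts the coordinates already integrated: [n = 0] compares indicators pointwise,
   [n = d] compares volumes. *)
have key n x : (n <= d)%N ->
    ((partial_volume a b (d - n) x)%:E <= \sum_(k <oo) F (d - n)%N x k)%E.
  elim: n x => [|n IH] x nd.
    rewrite subn0 partial_volume_full indicE.
    have [xab|] := pselect (box a b x); last first.
      by move=> ?; rewrite memNset//; apply: nneseries_ge0.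
    have [k Dk xk] := cov _ xab; rewrite mem_set//.
    apply: (@le_trans _ _ (F d x k)).
      by rewrite /F mem_set// partial_volume_full indicE mem_set.
    rewrite nneseries_esumT//; apply: esum_ge.
    exists [set k]; first by split.
    by rewrite fsbig_set1.
  have jd : (d - n.+1 < d)%N by rewrite ltn_subrL/=; case: (d) nd.
  pose i := Ordinal jd.
  have iE : i.+1 = (d - n)%N by rewrite /= -subSn// subSS.
  rewrite -[(d - n.+1)%N]/(i : nat) -integral_partial_volume//.
  have FE k : F i x k =
      (\int[lebesgue_measure]_r F i.+1 (row_set x i r) k)%E.
    rewrite /F; case: ifPn => [/set_mem kD|_]; last by rewrite integral0.
    by rewrite integral_partial_volume//; exact: akbk.
  under eq_eseriesr => k _ do rewrite FE.
  have mF k : measurable_fun setT (fun r => F i.+1 (row_set x i r) k).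
    by rewrite /F; case: (k \in D) => //; exact: measurable_partial_volume.
  rewrite -integral_nneseries//.
  apply: ge0_le_integral => //.
  - by move=> r _; rewrite lee_fin partial_volume_ge0.
  - exact: measurable_partial_volume.
  - have := @ge0_emeasurable_sum _ _ R setT
      (fun k r => F i.+1 (row_set x i r) k) predT.
    by apply.
  - by move=> r _; rewrite iE; apply: IH; exact: ltnW.
have := key d 0 (leqnn d); rewrite subnn partial_volume0 => /le_trans; apply.
rewrite nneseries_esumT// [leRHS]esum_mkcond.

by apply: le_esum => k _; rewrite /F; case: ifP.
Qed.

End box_lower_bound.

Section row_norm.
Variables (R : realType) (d : nat).
Implicit Types (x : 'rV[R]_d).

Lemma coord_le_norm x i : `|x 0 i| <= `|x|.
Proof.
have /mapP[j Hj ->] : `|x 0 i| \in [seq `|x j.1 j.2| | j : 'I_1 * 'I_d].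
  by apply/mapP; exists (0, i) => //=; rewrite mem_enum.
by rewrite [leRHS]/Num.norm /= mx_normrE; apply/bigmax_geP; right => /=; exists j.
Qed.

Lemma norm_le_coord x e : 0 <= e -> (forall i, `|x 0 i| <= e) -> `|x| <= e.
Proof.
move=> e0 xe; rewrite [leLHS]/Num.norm /= mx_normrE.
by apply/bigmax_leP; split => //= -[i j] _ /=; rewrite ord1.
Qed.

Lemma norm_coord x : x != 0 -> exists i, `|x| = `|x 0 i|.
Proof.
move=> x0; have [|[i j] /= xE] := @mx_norm_neq0 _ _ _ x.
  by apply: contra x0 => /eqP/mx_norm_eq0 ->.
by exists j; rewrite [LHS]xE ord1.
Qed.

End row_norm.

(** * Translation invariance and null sets *)

Section lebesgue_rV_theory.
Variables (R : realType) (d : nat).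
Implicit Types (x v : 'rV[R]_d) (A : set 'rV[R]_d).
Local Notation mu := (@lebesgue_rV R d).

Lemma measurable_open A : open A -> measurable (A : set (borel_rV R d)).
Proof. exact: sub_sigma_algebra. Qed.

Lemma measurable_closed A : closed A -> measurable (A : set (borel_rV R d)).
Proof.
move=> cA; rewrite -[A]setCK; apply: measurableC; apply: measurable_open.
exact: closed_openC.
Qed.

Lemma continuous_measurable_rV (f : 'rV[R]_d -> 'rV[R]_d) : continuous f ->
  measurable_fun setT (f : borel_rV R d -> borel_rV R d).
Proof.
move=> cf; apply: (@measurability _ _ (borel_rV R d) (borel_rV R d) setT f open) => //.
move=> _ [U oU <-].
rewrite setTI; apply: measurable_open; apply: open_comp => // x _; exact: cf.
Qed.

Lemma continuous_translation v : continuous (fun x => x + v).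
Proof. by move=> x; exact: (cvgD cvg_id (cvg_cst _)). Qed.

Lemma measurable_shift v A : measurable (A : set (borel_rV R d)) ->
  measurable ([set x | A (x + v)] : set (borel_rV R d)).
Proof.
move=> mA; rewrite -[X in measurable X]setTI.
exact: (continuous_measurable_rV (@continuous_translation v)).
Qed.

(** Translating a cover keeps its total volume; the reverse inequality is the same fact for
    [- v]. *)
Lemma lebesgue_outer_shift v A :
  lebesgue_outer [set x | A (x + v)] = lebesgue_outer A.
Proof.
have le (w : 'rV[R]_d) (B : set 'rV[R]_d) :
      (lebesgue_outer [set x | B (x + w)%R] <= lebesgue_outer B)%E.
  apply: le_ereal_inf_tmp => _ [D [a [b [[ab Bc] ->]]]].
  apply: ereal_inf_lbound; exists D, (fun k => a k - w), (fun k => b k - w).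
  split; first split.
  - by move=> k Dk i; rewrite !mxE lerB// ab.
  - move=> x /Bc[k Dk xk]; exists k => // i; have := xk i.
    by rewrite !mxE ltrBlDr lerBrDr.
  - apply: eq_esum => k _; congr (_%:E); apply: eq_bigr => i _.
    by rewrite !mxE opprB addrA subrK.
apply/eqP; rewrite eq_le le/=.
have := le (- v) [set x | A (x + v)]; congr (lebesgue_outer _ <= _)%E.
by apply/seteqP; split => x /=; rewrite subrK.
Qed.

Lemma negligible_shift v A :
  mu.-negligible A -> mu.-negligible [set x | A (x + v)].
Proof.
move=> [B [mB B0 AB]]; exists [set x | B (x + v)]; split.
- exact: measurable_shift.
- by rewrite /lebesgue_rV lebesgue_outer_shift.
- by move=> x; exact: AB.
Qed.

Lemma negligible_outer0 A : mu.-negligible A -> lebesgue_outer A = 0%E.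
Proof.
move=> [B [mB B0 AB]]; apply/eqP; rewrite eq_le lebesgue_outer_ge0 andbT.
by rewrite -B0 le_lebesgue_outer.
Qed.

Lemma lebesgue_outer_bounded A : bounded_set A -> (lebesgue_outer A < +oo)%E.
Proof.
move=> /ex_strict_bound_gt0[M M0 AM].
pose a : 'rV[R]_d := const_mx (- M); pose b : 'rV[R]_d := const_mx M.
apply: (@le_lt_trans _ _ (box_volume a b)%:E); last by rewrite ltry.
apply: ereal_inf_lbound; exists [set 0%N], (fun=> a), (fun=> b).
have ab i : a 0 i <= b 0 i by rewrite !mxE ge0_cp// ltW.
split; last first.
  rewrite esum_set1// lee_fin; apply: prodr_ge0 => i _; rewrite subr_ge0.
  exact: ab.
split=> // x Ax; exists 0%N => // i; rewrite !mxE.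
have := AM _ Ax => /(le_lt_trans (coord_le_norm x i)).
by rewrite ltr_norml => /andP[-> /ltW].
Qed.

(** Such a set contains a box with positive sides, whose outer measure [box_volume_le_outer] bounds
    from below. *)
Lemma lebesgue_outer_open_neq0 A : open A -> A !=set0 -> lebesgue_outer A != 0%E.
Proof.
move=> oA [x Ax].
have /nbhs_ballP[e /= e0 xeA] : nbhs x A by exact: open_nbhs_nbhs.
pose a := x - const_mx (e / 2); pose b := x + const_mx (e / 2).
have e20 : 0 < e / 2 by rewrite divr_gt0.
have ab i : a 0 i < b 0 i by rewrite !mxE; lra.
have v0 : 0 < box_volume a b by apply: prodr_gt0 => i _; rewrite subr_gt0.
rewrite gt_eqF//; apply: (@lt_le_trans _ _ (box_volume a b)%:E) => //.
apply: (le_trans (box_volume_le_outer (fun i => ltW (ab i)))).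
apply: le_lebesgue_outer => y yab; apply: xeA; rewrite -ball_normE /=.
apply: (@le_lt_trans _ _ (e / 2)); last by rewrite ltr_pdivrMr//; lra.
apply: norm_le_coord => [|i]; first exact: ltW.
have := yab i; rewrite !mxE => /andP[? ?]; rewrite ler_norml; lra.
Qed.

(** The translates of [A] by the multiples [- n.+1%:R^-1] of [e] are pairwise disjoint, have equal
    measure and lie in one bounded set. *)
Lemma negligible_disjoint_translates A (e : 'rV[R]_d) :
  measurable (A : set (borel_rV R d)) -> bounded_set A ->
  (forall x h, 0 < h -> A x -> ~ A (x + h *: e)) -> mu A = 0%E.
Proof.
move=> mA bA Ae; pose s (n : nat) : R := n.+1%:R^-1.
pose F n := [set x | A (x + s n *: e)].
have mF n : measurable (F n : set (borel_rV R d)) by exact: measurable_shift.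
have tF : trivIset setT F.
  apply/trivIsetP => /= i j _ _.
  wlog ij : i j / (i < j)%N.
    move=> H; rewrite neq_ltn => /orP[ij|ji]; first by apply: H; rewrite ?ltn_eqF.
    by rewrite setIC; apply: H; rewrite ?ltn_eqF.
  move=> _; rewrite -subset0 => x [/= Fi Fj].
  have h0 : 0 < s i - s j by rewrite subr_gt0 ltf_pV2 ?posrE// ltr_nat.
  apply: (Ae _ _ h0 Fj); suff -> : x + s j *: e + (s i - s j) *: e = x + s i *: e by [].
  by rewrite -addrA -scalerDl [s j + _]addrC subrK.
have bF : bounded_set (\bigcup_n F n).
  have [M M0 AM] := ex_strict_bound_gt0 bA.
  exists (M + `|e|); split; first by rewrite num_real.
  move=> N MN x [n _ Fx]; apply: le_trans (ltW MN).
  rewrite -(addrK (s n *: e) x); apply: (le_trans (ler_normB _ _)).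
  apply: lerD; first exact/ltW/AM.
  by rewrite normrZ gtr0_norm ?invr_gt0// ler_piMl// invf_le1// ler1n.
have := measure_semi_bigcup mu mF tF (bigcupT_measurable _ mF).
have E k : mu (F k) = mu A by exact: lebesgue_outer_shift.
rewrite (eq_eseriesr (fun k _ => E k)).
move=> H; have [->//|A_neq0] := eqVneq (mu A) 0%E.
have A0 : (0 < mu A)%E by rewrite lt0e A_neq0 lebesgue_outer_ge0.
suff oo : mu (\bigcup_n F n) = +oo%E.
  by have := lebesgue_outer_bounded bF; rewrite -[lebesgue_outer _]/(mu _) oo ltxx.
rewrite H; apply/eqyP => r r0.
have fA : mu A \is a fin_num.
  by rewrite ge0_fin_numE// lebesgue_outer_bounded.
have a0 : 0 < fine (mu A) by rewrite fine_gt0// A0 ltey_eq fA.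
pose N := Num.bound (r / fine (mu A)).
apply: (@le_trans _ _ (\sum_(0 <= i < N) mu A)%E); last first.
  exact: nneseries_lim_ge.
rewrite -(fineK fA) sumEFin lee_fin sumr_const_nat subn0 -mulr_natl.
by rewrite -ler_pdivrMr//; apply/ltW/archi_boundP; rewrite divr_ge0 ?ltW.
Qed.

(** The intersections with balls of integer radius fall under [negligible_disjoint_translates];
    closedness makes them measurable. *)
Lemma negligible_closed_slices A (e : 'rV[R]_d) : closed A ->
  (forall x h, 0 < h -> A x -> ~ A (x + h *: e)) -> mu.-negligible A.
Proof.
move=> cA Ae; pose B (n : nat) := A `&` [set x | `|x| <= n%:R].
have cB n : closed (B n).
  apply: closedI => //.
  rewrite (_ : [set x | _] = (fun x : 'rV[R]_d => `|x|) @^-1` [set r | r <= n%:R])//.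
  by apply: closed_comp => [x _|]; [exact: norm_continuous|exact: closed_le].
apply: (@negligibleS _ _ _ mu (\bigcup_n B n)).
  move=> x Ax; exists (Num.bound `|x|) => //; split => //=.
  exact/ltW/archi_boundP.
apply: negligible_bigcup => n.
have mB : measurable (B n : set (borel_rV R d)) by exact: measurable_closed.
have bB : bounded_set (B n).
  exists n%:R; split; first by rewrite num_real.
  by move=> M nM x [_ /= /le_trans]; apply; exact: ltW.
have sB x h : 0 < h -> B n x -> ~ B n (x + h *: e).
  by move=> h0 [Ax _] [Axh _]; exact: Ae h0 Ax Axh.
by exists (B n); split => //; exact: (negligible_disjoint_translates mB bB sB).
Qed.

Lemma negligible_bigcup_count (T : countType) (F : T -> set 'rV[R]_d) :
  (forall t, mu.-negligible (F t)) -> mu.-negligible (\bigcup_t F t).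
Proof.
move=> F0; pose G n := if unpickle n is Some t then F t else set0.
apply: (@negligibleS _ _ _ mu (\bigcup_n G n)).
  by move=> x [t _ Ftx]; exists (pickle t) => //; rewrite /G pickleK.
apply: negligible_bigcup => n; rewrite /G.
by case: unpickle => // ; exact: negligible_set0.
Qed.

End lebesgue_rV_theory.

(** * Subgradients and conjugates over a compact set *)

Lemma near_normP (R : realType) d (x : 'rV[R]_d) (P : set 'rV[R]_d) :
  (\forall y \near x, P y) <->
  exists2 e : R, 0 < e & forall y, `|y - x| < e -> P y.
Proof.
split=> [/nbhs_ballP[e /= e0 xP]|[e e0 xP]].
  by exists e => // y yx; apply: xP; rewrite -ball_normE /= distrC.
apply/nbhs_ballP; exists e => //= y; rewrite -ball_normE /= distrC; exact: xP.
Qed.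

Lemma continuous_normP (R : realType) d (f : 'rV[R]_d -> R) x :
  {for x, continuous f} <->
  forall e, 0 < e -> exists2 r, 0 < r & forall y, `|y - x| < r -> `|f y - f x| <= e.
Proof.
split=> [/(@cvgrPdist_le _ _ _ (nbhs x)) fx e e0|fx].
  have /near_normP[r r0 xr] := fx _ e0; exists r => // y /xr.
  by rewrite distrC.
apply/(@cvgrPdist_le _ _ _ (nbhs x)) => e /fx[r r0 xr]; apply/near_normP.
by exists r => // y /xr; rewrite distrC.
Qed.

Lemma within_continuous_normP (R : realType) d (K : set 'rV[R]_d)
    (f : 'rV[R]_d -> R) :
  {within K, continuous f} <->
  forall x, K x -> forall e, 0 < e ->
    exists2 r, 0 < r & forall y, K y -> `|y - x| < r -> `|f y - f x| <= e.
Proof.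
rewrite subspace_continuousP; split=> [fK x Kx e e0|fK x Kx].
  have /(@cvgrPdist_le _ _ _ (within K (nbhs x))) := fK x Kx.
  move=> /(_ _ e0)/near_normP[r r0 xr]; exists r => // y Ky yx.
  by rewrite distrC; exact: xr.
apply/(@cvgrPdist_le _ _ _ (within K (nbhs x))) => e /(fK _ Kx)[r r0 xr].
apply/near_normP; exists r => // y yx Ky; rewrite distrC; exact: xr.
Qed.

Lemma open_norm_lt (R : realType) d (x : 'rV[R]_d) e :
  open [set y | `|y - x| < e].
Proof.
rewrite openE => y ye; apply/near_normP; exists (e - `|y - x|).
  by rewrite subr_gt0.
move=> z zy; rewrite /= -(subrKA y) (le_lt_trans (ler_normD _ _))//.
by rewrite -ltrBrDr.
Qed.

Lemma compact_norm_le (R : realType) d (M : R) :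
  compact [set x : 'rV[R]_d | `|x| <= M].
Proof.
apply: bounded_closed_compact.
  exists M; split; first by rewrite num_real.
  by move=> N MN x /= /le_trans; apply; exact: ltW.
rewrite (_ : [set x | _] = (fun x : 'rV[R]_d => `|x|) @^-1` [set s | s <= M])//.
by apply: closed_comp => [x _|]; [exact: norm_continuous|exact: closed_le].
Qed.

(** * The scalar product and derivatives *)

Section dot_theory.
Variables (R : realType) (d : nat).
Implicit Types (u v w x y p : 'rV[R]_d).

Lemma dotC u v : dot u v = dot v u.
Proof. by apply: eq_bigr => i _; rewrite mulrC. Qed.

Lemma dotDl u v w : dot (u + v) w = dot u w + dot v w.
Proof. by rewrite /dot -big_split; apply: eq_bigr => i _; rewrite mxE mulrDl. Qed.

Lemma dotZl a u v : dot (a *: u) v = a * dot u v.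
Proof. by rewrite /dot mulr_sumr; apply: eq_bigr => i _; rewrite mxE mulrA. Qed.

Lemma dotNl u v : dot (- u) v = - dot u v.
Proof. by rewrite -scaleN1r dotZl mulN1r. Qed.

Lemma dotBl u v w : dot (u - v) w = dot u w - dot v w.
Proof. by rewrite dotDl dotNl. Qed.

Lemma dotDr u v w : dot u (v + w) = dot u v + dot u w.
Proof. by rewrite !(dotC u) dotDl. Qed.

Lemma dotZr a u v : dot u (a *: v) = a * dot u v.
Proof. by rewrite !(dotC u) dotZl. Qed.

Lemma dotNr u v : dot u (- v) = - dot u v.
Proof. by rewrite !(dotC u) dotNl. Qed.

Lemma dotBr u v w : dot u (v - w) = dot u v - dot u w.
Proof. by rewrite dotDr dotNr. Qed.

Definition dotE := (dotDl, dotDr, dotBl, dotBr, dotNl, dotNr, dotZl, dotZr).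

Lemma dot_delta u i : dot u (delta_mx 0 i) = u 0 i.
Proof.
rewrite /dot (bigD1 i)//= mxE !eqxx mulr1 big1 ?addr0// => j ji.
by rewrite mxE (negbTE ji) andbF mulr0.
Qed.

Lemma dot_le_norm u v : `|dot u v| <= d%:R * `|u| * `|v|.
Proof.
apply: (le_trans (ler_norm_sum _ _ _)).
rewrite -mulrA mulr_natl.
rewrite [leRHS](_ : _ = \sum_(i < d) `|u| * `|v|); last first.
  by rewrite sumr_const card_ord.
apply: ler_sum => i _; by rewrite normrM ler_pM// coord_le_norm.
Qed.

Lemma sqnorm_ge0 u : 0 <= sqnorm u.
Proof. by apply: sumr_ge0 => i _; rewrite -expr2 sqr_ge0. Qed.

Lemma sqnorm_gt0 u : u != 0 -> 0 < sqnorm u.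
Proof.
move=> u0; have [i ui] := norm_coord u0.
apply: (@lt_le_trans _ _ (u 0 i ^+ 2)).
  by rewrite exprn_even_gt0//= -normr_gt0 -ui normr_gt0.
rewrite /sqnorm /dot (bigD1 i)//= expr2 lerDl sumr_ge0// => j _.
by rewrite -expr2 sqr_ge0.
Qed.

Lemma dot_continuousr u : continuous (dot u).
Proof.
move=> x; apply/continuous_normP => e e0.
pose C := d%:R * `|u| + 1.
have C0 : 0 < C by rewrite ltr_wpDl// mulr_ge0.
exists (e / C) => [|y /ltW yx]; first by rewrite divr_gt0.
rewrite -dotBr (le_trans (dot_le_norm _ _))//.
apply: (@le_trans _ _ (C * `|y - x|)); first by rewrite ler_wpM2r// lerDl.
by rewrite -ler_pdivlMl// mulrC.
Qed.

Lemma dot_is_linear u : linear (dot u : 'rV[R]_d -> R^o).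
Proof. by move=> a v w; rewrite !dotE. Qed.

HB.instance Definition _ u :=
  GRing.isLinear.Build R 'rV[R]_d R^o _ (dot u) (dot_is_linear u).

(** Uniqueness of the differential identifies it with [dot p]; gradients of convexifications are
    computed through this criterion. *)
Lemma frechet_derivative (f : 'rV[R]_d -> R) p x :
  (forall e, 0 < e ->
    \forall y \near x, `|f y - f x - dot p (y - x)| <= e * `|y - x|) ->
  differentiable (f : 'rV[R]_d -> R^o) x /\
  forall v, 'D_v (f : 'rV[R]_d -> R^o) x = dot p v.
Proof.
move=> fp; pose g : {linear 'rV[R]_d -> R^o} := dot p.
have cg : continuous g by exact: dot_continuousr.
have fo : (f \o shift x : 'rV[R]_d -> R^o) = cst (f x : R^o) + g +o_ (0 : 'rV[R]_d) id.
  apply/eqaddoP => e /fp /near_normP[r r0 xr].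
  apply/near_normP; exists r => // y; rewrite subr0 => yr.
  have := xr (y + x); rewrite addrK => /(_ yr).
  by congr (`|_| <= _); rewrite /= opprD addrA.
have dg := @diff_unique R 'rV[R]_d R^o f g x cg fo.
have df : differentiable (f : 'rV[R]_d -> R^o) x.
  by apply/diff_locallyP; rewrite dg.
by split => // v; rewrite deriveE// dg.
Qed.

End dot_theory.

Section subgradients.
Variables (R : realType) (d : nat).
Implicit Types (f : 'rV[R]_d -> R) (u v x y p : 'rV[R]_d).
Local Notation mu := (@lebesgue_rV R d).

Definition subgradient f x u := forall y, f x + dot u (y - x) <= f y.

(** For a finite convex function these are the points where it is not differentiable. *)
Definition kinks f : set 'rV[R]_d :=
  [set x | exists u v, [/\ u != v, subgradient f x u & subgradient f x v]].

(* If [u] and [v] differ in the [i]-th coordinate, two rationals [q < r] between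
   [u_i] and [v_i] put [x] into a closed set that meets every line parallel to the
   [i]-th axis at most once. *)
Lemma negligible_kinks f : continuous f -> mu.-negligible (kinks f).
Proof.
move=> cf.
pose e (i : 'I_d) : 'rV[R]_d := delta_mx 0 i.
(* Along the axis [t.1.1], forward difference quotients at [x] are at least [t.2] and backward ones
   at most [t.1.2 < t.2]. Two points of the set on one such line would share a quotient satisfying
   both bounds. *)
pose E (t : 'I_d * rat * rat) : set 'rV[R]_d :=
  [set x | t.1.2 < t.2 /\ forall h, 0 < h ->
    f x + ratr t.2 * h <= f (x + h *: e t.1.1) /\
    f x - ratr t.1.2 * h <= f (x - h *: e t.1.1)].
apply: (@negligibleS _ _ _ mu (\bigcup_t E t)).
  move=> x [u [v [uv xu xv]]].
  have [i ui] : exists i, u 0 i != v 0 i.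
    apply: contrapT => /forallNP uvE; move/eqP: uv; apply; apply/rowP => i.
    by apply/eqP/negPn/negP; exact: uvE.
  wlog lt_vu : u v uv xu xv ui / v 0 i < u 0 i.
    move=> H; move: (ui); rewrite neq_lt => /orP[?|?]; last exact: (H u v).
    by apply: (H v u); rewrite // eq_sym.
  have [q] := rat_in_itvoo lt_vu; rewrite in_itv/= => /andP[vq qu].
  have [r] := rat_in_itvoo qu; rewrite in_itv/= => /andP[qr ru].
  exists (i, q, r) => //; split=> /=; first by rewrite -(ltr_rat R).
  move=> h h0; split.
    have := xu (x + h *: e i); rewrite addrAC subrr add0r dotZr dot_delta mulrC.
    by apply: le_trans; rewrite lerD2l ler_wpM2r// ltW.
  have := xv (x - h *: e i); rewrite addrAC subrr add0r dotNr dotZr dot_delta mulrC.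
  by apply: le_trans; rewrite lerD2l lerN2 ler_wpM2r// ltW.
apply: negligible_bigcup_count => -[[i q] r].
have [qr|qr] := boolP (q < r); last first.
  rewrite (_ : E _ = set0); first exact: negligible_set0.
  by apply/seteqP; split => // x [] /=; rewrite (negbTE qr).
apply: (@negligible_closed_slices _ _ _ (e i)); last first.
  move=> x h h0 [_ /(_ h h0)[/= + _]] [_ /(_ h h0)[/= _]].
  rewrite addrK => xE1 xE2.
  have : ratr q * h < ratr r * h :> R by rewrite ltr_pM2r// ltr_rat.
  by move: xE1 xE2; lra.
have cfD (v : 'rV[R]_d) : continuous (fun x => f (x + v) - f x).
  move=> x; apply: (@continuousB _ R^o _ (fun x => f (x + v)) f); last exact: cf.
  apply: (@continuous_comp _ _ _ (fun x => x + v) f); last exact: cf.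
  exact: continuous_translation.
(* Being cut out by weak inequalities on continuous functions, one pair for each [h], the set is
   closed. *)
rewrite (_ : E _ = \bigcap_(h in [set h | 0 < h])
  ((fun x => f (x + h *: e i) - f x) @^-1` [set s | ratr r * h <= s] `&`
   (fun x => f (x - h *: e i) - f x) @^-1` [set s | - (ratr q * h) <= s])).
  apply: closed_bigI => h h0; apply: closedI; apply: closed_comp.
  - by move=> x _; exact: cfD.
  - exact: closed_ge.
  - by move=> x _; exact: cfD.
  - exact: closed_ge.
apply/seteqP; split => [x [/= _ xE] h /= h0|x xE].
  by have [? ?] := xE h h0; split; lra.
split => // h h0; have [/= ? ?] := xE h h0; split; lra.
Qed.

End subgradients.

Section compact_conjugate.
Variables (R : realType) (d : nat) (K : set 'rV[R]_d) (c : 'rV[R]_d -> R).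
Hypotheses (K0 : K !=set0) (cK : compact K) (cc : {within K, continuous c}).
Implicit Types (u v x y z w : 'rV[R]_d).

(** Under the hypotheses of the section, the Legendre transform of [c] extended by infinity, as a
    real function. The construction is later iterated, with a ball of slopes in place of [K], to
    describe the convexification. *)
Definition compact_conjugate x : R := sup [set dot x z - c z | z in K].
Local Notation F := compact_conjugate.

(** Attainment shows that [sup], which has a default value when no supremum exists, is the true
    maximum here. *)
Lemma compact_conjugate_max x :
  exists z, [/\ K z, F x = dot x z - c z & forall w, K w -> dot x w - c w <= F x].
Proof.
have cf : {within K, continuous (fun z => dot x z - c z)}.
  have cd : {within K, continuous (dot x)}.
    exact/continuous_subspaceT/dot_continuousr.
  exact: within_continuousB.
have [z /set_mem Kz zmax] := compact_EVT_max K0 cK cf.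
have ub : ubound [set dot x z - c z | z in K] (dot x z - c z).
  by move=> _ [w Kw <-]; apply: zmax; exact: mem_set.
have FE : F x = dot x z - c z.
  apply/eqP; rewrite eq_le ge_sup//=; last by exists (dot x z - c z), z.
  by apply: ub_le_sup; [exists (dot x z - c z)|exists z].
by exists z; split => // w Kw; rewrite FE; apply: ub; exists w.
Qed.

Lemma compact_conjugate_ge x w : K w -> dot x w - c w <= F x.
Proof. by have [z [_ _]] := compact_conjugate_max x; apply. Qed.

Lemma compact_conjugate_subgradient x z :
  K z -> F x = dot x z - c z -> subgradient F x z.
Proof.
move=> Kz FE y; rewrite FE; apply: le_trans (compact_conjugate_ge y Kz).
by rewrite dotBr !(dotC z); lra.
Qed.

Lemma compact_conjugate_bound :
  exists2 L, 0 < L & forall x z, K z -> `|dot x z| <= L * `|x|.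
Proof.
have [M M0 KM] := ex_strict_bound_gt0 (compact_bounded cK).
exists (d%:R * M + 1) => [|x z Kz]; first by rewrite ltr_wpDl// mulr_ge0// ltW.
apply: (le_trans (dot_le_norm _ _)); rewrite mulrAC ler_wpM2r//.
apply: (@le_trans _ _ (d%:R * M)); last by rewrite lerDl.
by rewrite ler_wpM2l// ltW// KM.
Qed.

Lemma compact_conjugate_lipschitz L :
  (forall x z, K z -> `|dot x z| <= L * `|x|) ->
  forall x y, `|F x - F y| <= L * `|x - y|.
Proof.
move=> KL.
have H x y : F x - F y <= L * `|x - y|.
  have [z [Kz -> _]] := compact_conjugate_max x.
  apply: le_trans (le_trans (ler_norm _) (KL (x - y) z Kz)).
  by have := compact_conjugate_ge y Kz; rewrite dotBl; lra.
by move=> x y; rewrite ler_norml H andbT lerNl opprB distrC H.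
Qed.

Lemma compact_conjugate_continuous : continuous F.
Proof.
have [L L0 KL] := compact_conjugate_bound.
move=> x; apply/continuous_normP => e e0; exists (e / L); first exact: divr_gt0.
move=> y /ltW yx; apply: (le_trans (compact_conjugate_lipschitz KL _ _)).
by rewrite mulrC -ler_pdivlMr.
Qed.

(* Near [x] every maximizer is close to [z]: away from [z] the maximum is smaller
   than [F x] by a fixed amount. *)
Lemma compact_conjugate_derivative x z : ~ kinks F x ->
  K z -> F x = dot x z - c z -> forall e, 0 < e ->
  \forall y \near x, `|F y - F x - dot z (y - x)| <= e * `|y - x|.
Proof.
move=> nkx Kz Fz e e0.
have [L L0 KL] := compact_conjugate_bound.
(* The denominator absorbs the dimension factor of [dot_le_norm]. *)
pose e' := e / (d%:R + 1).
have e'0 : 0 < e' by rewrite divr_gt0// ltr_wpDl.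
pose K' := K `&` [set w | e' <= `|w - z|].
have [eta eta0 etaP] : exists2 eta, 0 < eta &
    forall w, K' w -> dot x w - c w <= F x - eta.
  have [K'0|K'0] := pselect (K' !=set0); last first.
    by exists 1 => // w K'w; exfalso; apply: K'0; exists w.
  have cK' : compact K'.
    rewrite /K'; apply: compact_closedI => //.
    rewrite (_ : [set w | _] = (fun w : 'rV[R]_d => `|w - z|) @^-1` [set r | e' <= r])//.
    apply: (@closed_comp _ _ (fun w : 'rV[R]_d => `|w - z|)); last exact: closed_ge.
    move=> w _; apply/continuous_normP => r r0; exists r => // y /ltW; apply: le_trans.
    by rewrite (le_trans (ler_dist_dist _ _))// opprB addrA subrK.
  have cc' : {within K', continuous c}.
    by apply: continuous_subspaceW cc => w [].
  have cf : {within K', continuous (fun w => dot x w - c w)}.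
    have cd : {within K', continuous (dot x)}.
      exact/continuous_subspaceT/dot_continuousr.
    exact: within_continuousB.
  have [w /set_mem[Kw /= wz] wmax] := compact_EVT_max K'0 cK' cf.
  exists (F x - (dot x w - c w)) => [|w' K'w']; last first.
    by rewrite subKr; apply: wmax; exact: mem_set.
  rewrite subr_gt0 lt_neqAle compact_conjugate_ge// andbT.
  apply/eqP => /esym Fw; apply: nkx; exists w, z; split.
  - by rewrite -subr_eq0 -normr_gt0 (lt_le_trans e'0).
  - exact: compact_conjugate_subgradient.
  - exact: compact_conjugate_subgradient.
(* From [x] to [y], [F] and each affine function in the maximum change by at most [L * |y - x|].
   Within this radius the total stays under the gap [eta], so no maximizer at [y] is far from
   [z]. *)
apply/near_normP; exists (eta / (2 * L)) => [|y yx].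
  by rewrite divr_gt0// mulr_gt0.
have Lyx : 2 * L * `|y - x| < eta by rewrite mulrC -ltr_pdivlMr// mulr_gt0.
have [w [Kw Fw _]] := compact_conjugate_max y.
have wz : `|w - z| <= e'.
  rewrite leNgt; apply/negP => /ltW we.
  have := etaP w (conj Kw we).
  have := compact_conjugate_lipschitz KL y x.
  have := KL (y - x) w Kw.
  by rewrite !ler_norml dotBl => /andP[? ?] /andP[? ?]; lra.
have lo : 0 <= F y - F x - dot z (y - x).
  by have := compact_conjugate_subgradient Kz Fz y; lra.
(* The maximizer [w] at [y] also competes at [x], which bounds the remainder by
   [dot (w - z) (y - x)]. *)
rewrite ger0_norm//; apply: (@le_trans _ _ (dot (w - z) (y - x))).
  have := compact_conjugate_ge x Kw; rewrite Fw dotBl !dotBr !(dotC w) !(dotC z).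
  lra.
apply: (le_trans (ler_norm _)); apply: (le_trans (dot_le_norm _ _)).
rewrite ler_wpM2r//; apply: (@le_trans _ _ (d%:R * e')); first by rewrite ler_wpM2l.
by rewrite /e' mulrCA ler_piMr ?ltW// ltr_pdivrMr ?ltr_wpDl// mul1r ltrDl.
Qed.

End compact_conjugate.

(** * The convexification of a function on a compact set *)

Section convexification_on_compact.
Variables (R : realType) (d : nat) (K : set 'rV[R]_d) (c : 'rV[R]_d -> R).
Hypotheses (K0 : K !=set0) (cK : compact K) (cc : {within K, continuous c}).
Implicit Types (u v x y z w p : 'rV[R]_d).
Local Notation mu := (@lebesgue_rV R d).
Local Notation F := (compact_conjugate K c).

(** With [K] the closure of [Omega] and a suitable [c], this is [psi] by conversion. *)
Definition extend_pinfty z : \bar R := if z \in K then (c z)%:E else +oo%E.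
Local Notation f := extend_pinfty.

Lemma legendre_compact x : legendre f x = (F x)%:E.
Proof.
apply/eqP; rewrite eq_le; apply/andP; split.
  apply: ge_ereal_sup => _ [z _ <-]; rewrite /f; case: ifPn => [|_].
    by move=> /set_mem Kz; rewrite lee_fin compact_conjugate_ge.
  by rewrite /= leNye.
have [z [Kz -> _]] := compact_conjugate_max K0 cK cc x.
by apply: ereal_sup_ubound; exists z => //; rewrite /f mem_set.
Qed.

Lemma convexificationE y :
  convexification f y = ereal_sup (range (fun p => (dot y p - F p)%:E)).
Proof.
rewrite /convexification (_ : legendre f = fun p => (F p)%:E)//.
by apply/funext => p; exact: legendre_compact.
Qed.

Lemma convexification_ge y p : ((dot y p - F p)%:E <= convexification f y)%E.
Proof. by rewrite convexificationE; apply: ereal_sup_ubound; exists p. Qed.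

Lemma convexification_le y : K y -> (convexification f y <= (c y)%:E)%E.
Proof.
move=> Ky; rewrite convexificationE; apply: ge_ereal_sup => _ [p _ <-].
by rewrite lee_fin; have := compact_conjugate_ge K0 cK cc p Ky; rewrite dotC; lra.
Qed.

(* A slope [p] with [r |p| > max c + F 0] cannot be optimal at a point whose
   [r]-neighborhood lies in [K]. *)
Lemma convexification_local r : 0 < r -> exists2 M, 0 <= M &
  forall y, (forall z, `|z - y| <= r -> K z) ->
    convexification f y =
    (compact_conjugate [set p | `|p| <= M] F y)%:E.
Proof.
move=> r0; have [zC _ zCmax] := compact_EVT_max K0 cK cc.
pose C := c zC; pose M := Num.max 0 ((C + F 0) / r).
have M0 : 0 <= M by rewrite le_max lexx.
exists M => // y yK.
have B0 : [set p : 'rV[R]_d | `|p| <= M] !=set0 by exists 0; rewrite /= normr0.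
have cB := @compact_norm_le R d M.
have cF : {within [set p : 'rV[R]_d | `|p| <= M], continuous F}.
  exact/continuous_subspaceT/(compact_conjugate_continuous K0 cK cc).
rewrite convexificationE; apply/eqP; rewrite eq_le; apply/andP; split; last first.
  have [p [_ -> _]] := compact_conjugate_max B0 cB cF y.
  by apply: ereal_sup_ubound; exists p.
apply: ge_ereal_sup => _ [p _ <-]; rewrite lee_fin.
have [pM|Mp] := leP `|p| M; first exact: compact_conjugate_ge.
have p0 : p != 0 by rewrite -normr_gt0 (le_lt_trans M0).
have [i pi] := norm_coord p0.
(* The point at distance [r] from [y] along the axis of a largest coordinate of [p], signed so that
   [dot p z = dot p y + r * |p|]. *)
pose z := y + (Num.sg (p 0 i) * r) *: delta_mx 0 i.
have Kz : K z.
  apply: yK; rewrite addrAC subrr add0r; apply: norm_le_coord; first exact: ltW.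
  move=> j; rewrite !mxE eqxx /= !normrM normr_sg (gtr0_norm r0).
  have -> : p 0 i != 0 by rewrite -normr_gt0 -pi normr_gt0.
  rewrite mul1r ler_piMr ?(ltW r0)//.
  by case: (j == i); rewrite ?normr1 ?normr0.
have pz : dot p z = dot p y + r * `|p|.
  by rewrite dotDr dotZr dot_delta pi normrEsg; congr (_ + _); rewrite mulrCA mulrA.
have := compact_conjugate_ge K0 cK cc p Kz; rewrite pz => Fp.
have cz : c z <= C by apply: zCmax; exact: mem_set.
have rp : C + F 0 <= r * `|p|.
  rewrite mulrC -ler_pdivrMr//; apply: le_trans (ltW Mp).
  by rewrite le_max lexx orbT.
(* The slope 0 already gives [- F 0], while [p] gives at most [C - r * |p|]. *)
have : dot y 0 - F 0 <= compact_conjugate [set p | `|p| <= M] F y.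
  by apply: compact_conjugate_ge => //=; rewrite normr0.
have -> : dot y 0 = 0 by rewrite /dot big1// => j _; rewrite mxE mulr0.
by rewrite (dotC y); lra.
Qed.

(* At a point [y] where [convexification f] is differentiable with gradient [p] and
   lies strictly below [c], both [y] and a maximizer of [dot p z - c z] are
   subgradients of [F] at [p], and they differ. *)
Lemma gradient_absolutely_continuous_subgradient (U : set 'rV[R]_d) :
  open U -> U `<=` K ->
  gradient_pushforward (convexification f) `<< mu ->
  forall y, U y -> exists p, forall x, K x -> c y + dot p (x - y) <= c x.
Proof.
move=> oU UK ac y0 Uy0; apply: contrapT => noslope.
have /near_normP[e e0 y0U] : nbhs y0 U by exact: open_nbhs_nbhs.
pose r := e / 2; have r0 : 0 < r by rewrite divr_gt0.
have re : r < e by rewrite /r; lra.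
have [M M0 fM] := convexification_local r0.
set BM := [set p | `|p| <= M] in fM; set g := compact_conjugate BM F in fM.
have B0 : BM !=set0 by exists 0; rewrite /BM /= normr0.
have cB : compact BM by exact: compact_norm_le.
have cF : {within BM, continuous F}.
  exact/continuous_subspaceT/(compact_conjugate_continuous K0 cK cc).
have cg : continuous g by exact: compact_conjugate_continuous.
have fE y : `|y - y0| < r -> convexification f y = (g y)%:E.
  move=> yr; apply: fM => z zy; apply: UK; apply: y0U.
  by rewrite -(subrKA y) (le_lt_trans (ler_normD _ _))// (splitr e) ler_ltD.
(* Otherwise a slope attaining [g y0] would support [c] at [y0], against [noslope]. *)
have gc0 : g y0 < c y0.
  rewrite ltNge; apply/negP => cg0; apply: noslope.
  have [p [_ gE _]] := compact_conjugate_max B0 cB cF y0.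
  exists p => x Kx; have := compact_conjugate_ge K0 cK cc p Kx.
  by move: cg0; rewrite /g gE dotBr (dotC y0); lra.
have [del [del0 delr gc]] : exists del, [/\ 0 < del, del <= r &
    forall y, `|y - y0| < del -> g y < c y].
  pose h := (c y0 - g y0) / 3; have h0 : 0 < h by rewrite /h; lra.
  have [d1 d10 gd] := (continuous_normP _ _).1 (cg y0) _ h0.
  have [d2 d20 cd] := (within_continuous_normP _ _).1 cc _ (UK _ Uy0) _ h0.
  exists (Num.min r (Num.min d1 d2)); split.
  - by rewrite !lt_min r0 d10.
  - by rewrite ge_min lexx.
  move=> y; rewrite !lt_min => /and3P[yr yd1 yd2].
  have Ky : K y by apply/UK/y0U/(lt_trans yr).
  have := gd _ yd1; have := cd _ Ky yd2.
  by rewrite !ler_norml /h => /andP[? ?] /andP[? ?]; lra.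
have nF : mu.-negligible (kinks F).
  exact/negligible_kinks/compact_conjugate_continuous.
have ng : mu.-negligible (kinks g) by exact: negligible_kinks.
(* [kinks F] is only known to be negligible, so absolute continuity is applied to a measurable null
   set [B] containing it. *)
have [B [mB B_null FB]] := nF.
pose T := [set y | ediffble (convexification f) y /\
                   B (egradient (convexification f) y)].
have T0 : lebesgue_outer T = 0%E.
  have /ac : (mu : set (borel_rV R d) -> \bar R).-null_set B.
    exact/measure0_null_setP.
  by move=> /(_ B mB (@subset_refl _ B)).
pose V := [set y | `|y - y0| < del].
have oV : open V by exact: open_norm_lt.
have : lebesgue_outer V != 0%E.
  by apply: lebesgue_outer_open_neq0 => //; exists y0; rewrite /V /= subrr normr0.
move/negP; apply; rewrite eq_le lebesgue_outer_ge0 andbT.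
(* Off [kinks g] the convexification is differentiable and its gradient is a kink of [F], so two
   null sets cover the nonempty open set [V]. *)
apply: (@le_trans _ _ (lebesgue_outer (kinks g `|` T))); last first.
  apply: (@le_trans _ _ (lebesgue_outer (kinks g) + lebesgue_outer T)%E).
    exact: outer_measureU2.
  by rewrite T0 adde0 (negligible_outer0 ng).
apply: le_lebesgue_outer => y Vy.
have [gy|gy] := pselect (kinks g y); [by left|right].
have [p [Bp gE _]] := compact_conjugate_max B0 cB cF y.
have nearf : \forall x \near y, convexification f x = (g x)%:E.
  apply: filterS (open_nbhs_nbhs (conj oV Vy)) => x Vx; apply: fE.
  exact: lt_le_trans Vx delr.
have [df Df] : differentiable (fine \o convexification f : 'rV[R]_d -> R^o) y /\
    forall v, 'D_v (fine \o convexification f : 'rV[R]_d -> R^o) y = dot p v.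
  apply: frechet_derivative => e1 e10.
  have := compact_conjugate_derivative B0 cB cF gy Bp gE e10.
  apply: filterS2 (nearf) => x fx.
  by rewrite /= fx (nbhs_singleton nearf).
have grad : egradient (convexification f) y = p.
  by apply/rowP => i; rewrite mxE Df dot_delta.
split; [split=> //|].
  by apply: filterS nearf => x ->.
rewrite grad; apply: FB.
have [z [Kz Fz _]] := compact_conjugate_max K0 cK cc p.
exists y, z; split; last exact: compact_conjugate_subgradient Kz Fz.
  apply/eqP => yz; have := gc _ Vy; rewrite -/g in gE; rewrite gE Fz yz dotC; lra.
move=> p'; have := convexification_ge y p'.
rewrite (nbhs_singleton nearf) lee_fin -/g in gE *; rewrite gE dotBr; lra.
Qed.

End convexification_on_compact.

(** * Semiconvex and affine almost everywhere implies convex *)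

Section convexity_criterion.
Variable R : realType.

(** An excess over the chord would survive the addition of a parabola and produce an interior
    maximum. Only some arbitrarily small [h] is required, which is what Fatou's lemma can supply. *)
Lemma second_difference_convex (J : R -> R) :
  {within `[0, 1], continuous J} ->
  (forall s e r, 0 < s < 1 -> 0 < e -> 0 < r -> exists2 h, 0 < h < r &
    - (e * h ^+ 2) <= J (s + h) + J (s - h) - 2 * J s) ->
  forall s, 0 <= s <= 1 -> J s <= (1 - s) * J 0 + s * J 1.
Proof.
move=> cJ Jdiff s s01; rewrite leNgt; apply/negP => Js.
pose e := J s - ((1 - s) * J 0 + s * J 1).
have e0 : 0 < e by rewrite subr_gt0.
(* At an interior maximum of [H] the second differences of [J] are at most
   [- 2 e h ^ 2]. *)
pose H s := J s + (s * (J 0 - J 1) + e * (s ^+ 2 - s)).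
have cH : {within `[0, 1], continuous H}.
  apply: within_continuousD => //; apply: continuous_subspaceT => z.
  apply: cvgD.
    by apply: cvgMr_tmp; exact: cvg_id.
  apply: cvgMl_tmp; apply: cvgB; last exact: cvg_id.
  exact: exprn_continuous.
have [z z01 zmax] := EVT_max ler01 cH.
move: z01; rewrite in_itv/= => z01.
have H0 : H 0 = J 0 by rewrite /H expr0n/=; lra.
have H1 : H 1 = J 0 by rewrite /H expr1n; lra.
have sz : H s <= H z by apply: zmax; rewrite in_itv.
(* Since [s ^+ 2 - s >= - 1 / 4], the parabola takes away at most a quarter of the excess [e]. *)
have Hs : J 0 < H s.
  have -> : H s = J 0 + e * (s ^+ 2 - s + 1) by rewrite /H /e; ring.
  rewrite ltrDl mulr_gt0//; have := sqr_ge0 (s - 1 / 2); rewrite sqrrB; lra.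
have z0 : 0 < z.
  rewrite lt_neqAle (andP z01).1 andbT; apply/eqP => z0.
  by move: sz Hs; rewrite -z0 H0; lra.
have z1 : z < 1.
  rewrite lt_neqAle (andP z01).2 andbT; apply/eqP => z1.
  by move: sz Hs; rewrite z1 H1; lra.
have [h /andP[h0]] := Jdiff z e (Num.min z (1 - z)) ltac:(lra) e0
  ltac:(by rewrite lt_min z0 subr_gt0).
rewrite lt_min => /andP[hz hz1] hJ.
have : H (z + h) <= H z by apply: zmax; rewrite in_itv/=; lra.
have : H (z - h) <= H z by apply: zmax; rewrite in_itv/=; lra.
rewrite /H.
have : 0 < e * h ^+ 2 by rewrite mulr_gt0// exprn_gt0.
by move: hJ; nra.
Qed.

Lemma limn_einf_ge (u : (\bar R)^nat) c N :
  (forall n, (N <= n)%N -> (c <= u n)%E) -> (c <= limn_einf u)%E.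
Proof.
move=> cu; rewrite limn_einf_lim; apply: lime_ge; first exact: is_cvg_einfs.
exists N => // n /= Nn; apply: le_ereal_inf_tmp => _ [m /= nm <-].
exact/cu/(leq_trans Nn).
Qed.

Lemma limn_einf_le (u : (\bar R)^nat) c :
  (forall n, (u n <= c)%E) -> (limn_einf u <= c)%E.
Proof.
move=> uc; rewrite limn_einf_lim; apply: lime_le; first exact: is_cvg_einfs.
by apply: nearW => n; apply: le_trans (uc n); apply: ereal_inf_lbound; exists n => /=.
Qed.

(** Fatou's lemma applies to the nonnegative functions [g n + C], whose lower limit is at least [C]
    almost everywhere on [Q]; the integrals of [g n] therefore cannot all stay below [- e]. *)
Lemma fatou_lower_bound dd (T : measurableType dd)
    (mu : {measure set T -> \bar R}) (Q : set T) (g : nat -> T -> R) (C : R) :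
  measurable Q -> (mu Q < +oo)%E -> 0 <= C ->
  (forall n, mu.-integrable Q (EFin \o g n)) ->
  (forall n u, Q u -> - C <= g n u) ->
  {ae mu, forall u, Q u -> exists N, forall n, (N <= n)%N -> 0 <= g n u} ->
  forall e, 0 < e -> exists n, - e <= \int[mu]_(u in Q) g n u.
Proof.
move=> mQ Qoo C0 ig gC g0 e e0; apply: contrapT => /forallNP ge.
pose m := fine (mu Q).
have iC : mu.-integrable Q (EFin \o cst C).
  apply: measurable_bounded_integrable => //.
  by exists C; split; rewrite ?num_real// => M CM u _ /=; rewrite ger0_norm// ltW.
have igC n : mu.-integrable Q (EFin \o (fun u => g n u + C)).
  by have := integrableD mQ (ig n) iC; apply: eq_integrable.
pose f n u := (g n u + C)%:E.
have mf n : measurable_fun Q (f n) by exact: (measurable_int mu (igC n)).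
have f0 n u : Q u -> (0 <= f n u)%E by move=> Qu; rewrite lee_fin; have := gC n _ Qu; lra.
have intf n : (\int[mu]_(u in Q) f n u = (\int[mu]_(u in Q) g n u + C * m)%:E)%E.
  rewrite -Rintegral_cst// -RintegralD//.
  by rewrite /Rintegral fineK//; exact: (integrable_fin_num mQ (igC n)).
have up : (\int[mu]_(u in Q) limn_einf (f^~ u) <= (C * m - e)%:E)%E.
  apply: (le_trans (fatou mu mQ mf f0)); apply: limn_einf_le => n.
  by rewrite intf lee_fin; have /negP := ge n; rewrite -ltNge; lra.
have : ((C * m)%:E <= (C * m - e)%:E)%E.
  apply: le_trans up.
  rewrite -Rintegral_cst// /Rintegral fineK; last exact: (integrable_fin_num mQ iC).
  apply: ae_ge0_le_integral => //.
  - move=> u Qu; apply: (@limn_einf_ge _ _ 0) => n _; exact: f0.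
  (* A change of sign reduces the measurability of a lower limit to that of an upper limit. *)
  - rewrite [X in measurable_fun _ X](_ : _ =
        -%E \o (fun u => limn_esup ((fun n => -%E \o f n) ^~ u))).
      apply: (measurableT_comp (@oppe_measurable R setT)).
      apply: measurable_fun_limn_esup => n.
      exact: (measurableT_comp (@oppe_measurable R setT) (mf n)).
    apply/funext => u; rewrite -[RHS]/(- limn_esup (-%E \o f^~ u))%E.
    by rewrite limn_esupN oppeK.
  apply: filterS g0 => u uN Qu; have [N NP] := uN Qu.
  by apply: (@limn_einf_ge _ _ N) => n /NP gn; rewrite lee_fin; lra.
by rewrite lee_fin; lra.
Qed.

End convexity_criterion.

Section convex_sets.
Variables (R : realType) (d : nat) (U : set 'rV[R]_d).
Hypothesis cU : convex_set U.

Lemma convex_set_segment x y s : U x -> U y -> 0 <= s <= 1 ->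
  U (x + s *: (y - x)).
Proof.
move=> Ux Uy /andP[s0 s1].
have := cU (Itv01 s0 s1) (mem_set Uy) (mem_set Ux) => /set_mem.
congr (U _); rewrite [LHS](_ : _ = s *: y + (1 - s) *: x)//.
by apply/rowP => i; rewrite !mxE; ring.
Qed.

End convex_sets.

(** * Convexity through averages over translations *)

Section mollification.
Variables (R : realType) (d : nat) (U : set 'rV[R]_d) (phi : 'rV[R]_d -> R).
Hypotheses (oU : open U) (cU : convex_set U).
Local Notation mu := (@lebesgue_rV R d).

Lemma measurable_restrict_open : (forall x, U x -> {for x, continuous phi}) ->
  measurable_fun setT ((fun z => if z \in U then phi z else 0) : borel_rV R d -> R).
Proof.
move=> cphi; apply: (@measurability _ _ (borel_rV R d) _ setT _ (@RGenOInfty.G R)).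
  exact: RGenOInfty.measurableE.
move=> _ [_ [a ->] <-]; rewrite setTI.
have mU : measurable (U : set (borel_rV R d)) by exact: measurable_open.
have oUa : open [set z | U z /\ a < phi z].
  rewrite openE => z [Uz az]; apply: filterI; first exact: open_nbhs_nbhs.
  have e0 : 0 < (phi z - a) / 2 by rewrite divr_gt0// subr_gt0.
  have [r r0 zr] := (continuous_normP _ _).1 (cphi z Uz) _ e0.
  apply/near_normP; exists r => // w /zr.
  by rewrite ler_norml => /andP[? _]; lra.
(* Off [U] the function is 0, so the complement of [U] belongs to the preimage exactly when
   [a < 0]. *)
rewrite (_ : _ @^-1` _ = [set z | U z /\ a < phi z] `|`
    (if a < 0 then ~` U else set0)).
  apply: measurableU; first exact: measurable_open.
  by case: ifP => _; [exact: measurableC|exact: measurable0].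
apply/seteqP; split => z /=; rewrite in_itv/= andbT.
  have [Uz|Uz] := pselect (U z); first by rewrite mem_set//; left.
  by rewrite memNset// => ->; right.
move=> [[Uz az]|]; first by rewrite mem_set.
by case: ifP => // a0 nUz; rewrite memNset.
Qed.

(** Averages over a small ball of translations are convex along the segment by [fatou_lower_bound]
    and [second_difference_convex]; a violation by [phi] would persist for such averages. *)
Lemma convex_of_ae_affine B C :
  (forall x, U x -> `|phi x| <= B) ->
  (forall x, U x -> {for x, continuous phi}) ->
  (\forall x \ae mu, U x -> locally_affine_at phi x) -> 0 <= C ->
  (forall z v, U z -> U (z + v) -> U (z - v) ->
    - (C * sqnorm v) <= phi (z + v) + phi (z - v) - 2 * phi z) ->
  forall x y s, U x -> U y -> 0 <= s <= 1 ->
    phi (x + s *: (y - x)) <= (1 - s) * phi x + s * phi y.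
Proof.
move=> phiB cphi ae_aff C0 semi x y s1 Ux Uy s101.
rewrite leNgt; apply/negP => viol.
pose v := y - x; pose gam (s : R) := x + s *: v.
(* Extended by 0, the function is bounded and measurable, so all its translates are integrable over
   [Q]. *)
pose Phi z := if z \in U then phi z else 0.
have PhiE z : U z -> Phi z = phi z by move=> Uz; rewrite /Phi mem_set.
have B0 : 0 <= B by apply: le_trans (phiB _ Ux).
have PhiB z : `|Phi z| <= B.
  by rewrite /Phi; case: ifPn => [/set_mem/phiB//|_]; rewrite normr0.
have mPhi : measurable_fun setT (Phi : borel_rV R d -> R).
  exact: measurable_restrict_open.
have nearU z : U z -> exists2 r : R, 0 < r & forall w, `|w| < r -> U (z + w).
  move=> Uz; have /near_normP[r r0 zU] : nbhs z U by exact: open_nbhs_nbhs.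
  by exists r => // w wr; apply: zU; rewrite addrAC subrr add0r.
(* The segment is prolonged so that [J] below is defined, hence continuous, on an
   open interval containing [[0, 1]]. *)
have [del [del0 Uxd Uyd]] : exists del : R, [/\ 0 < del,
    U (x - del *: v) & U (y + del *: v)].
  have [r1 r10 xU] := nearU x Ux; have [r2 r20 yU] := nearU y Uy.
  pose r := Num.min r1 r2; have r0 : 0 < r by rewrite lt_min r10.
  have v1 : 0 < `|v| + 1 by rewrite ltr_wpDl.
  exists (r / (`|v| + 1)); split; first exact: divr_gt0.
  - apply: xU; rewrite normrN normrZ gtr0_norm ?divr_gt0//.
    rewrite (lt_le_trans (y := r))//; last by rewrite ge_min lexx.
    by rewrite mulrAC ltr_pdivrMr// ltr_pM2l// ltrDl.
  - apply: yU; rewrite normrZ gtr0_norm ?divr_gt0//.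
    rewrite (lt_le_trans (y := r))//; last by rewrite ge_min lexx orbT.
    by rewrite mulrAC ltr_pdivrMr// ltr_pM2l// ltrDl.
have [r0 r00 gamU] : exists2 r : R, 0 < r & forall s u, - del <= s <= 1 + del ->
    `|u| < r -> U (gam s + u).
  have [r1 r10 xU] := nearU _ Uxd; have [r2 r20 yU] := nearU _ Uyd.
  exists (Num.min r1 r2) => [|s u sI]; first by rewrite lt_min r10.
  rewrite lt_min => /andP[ur1 ur2].
  (* The relative position of [gam s] on the prolonged segment, along which convexity carries the
     balls around its ends. *)
  pose k := (s + del) / (1 + 2 * del).
  have k01 : 0 <= k <= 1.
    by rewrite divr_ge0 ?ler_pdivrMr /=; lra.
  have := convex_set_segment cU (xU _ ur1) (yU _ ur2) k01; congr (U _).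
  rewrite /gam; have -> : y = x + v by rewrite /v addrC subrK.
  apply/rowP => i; rewrite !mxE /k; field; lra.
have gamU0 s : 0 <= s <= 1 -> U (gam s).
  by move=> sI; rewrite -[gam s]addr0; apply: gamU; rewrite ?normr0//; lra.
(* Under a small translation the value at [gam s1] and the chord value each move by at most [eta],
   so a third of the violation remains. *)
pose eta := (phi (gam s1) - ((1 - s1) * phi x + s1 * phi y)) / 3.
have eta0 : 0 < eta by rewrite divr_gt0// subr_gt0.
have near3 z : U z -> exists2 r, 0 < r &
    forall u, `|u| < r -> `|phi (z + u) - phi z| <= eta.
  move=> /cphi /continuous_normP /(_ _ eta0)[r rr0 zr]; exists r => // u ur.
  by apply: zr; rewrite addrAC subrr add0r.
have [rx rx0 xr] := near3 x Ux; have [ry ry0 yr] := near3 y Uy.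
have [rg rg0 gr] := near3 (gam s1) (gamU0 _ s101).
pose r := Num.min r0 (Num.min rx (Num.min ry rg)).
have rr0 : 0 < r by rewrite !lt_min r00 rx0 ry0.
pose Q := [set u : 'rV[R]_d | `|u| < r].
have oQ : open Q.
  rewrite (_ : Q = [set u | `|u - 0| < r]); first exact: open_norm_lt.
  by apply/seteqP; split => u /=; rewrite subr0.
have mQ : measurable (Q : set (borel_rV R d)) by exact: measurable_open.
have Qoo : (mu Q < +oo)%E.
  apply: lebesgue_outer_bounded; exists r; split; first by rewrite num_real.
  by move=> M rM u /= /ltW /le_trans; apply; exact: ltW.
have Q0 : 0 < fine (mu Q).
  rewrite fine_gt0// Qoo andbT lt0e measure_ge0 andbT.
  by apply: lebesgue_outer_open_neq0 => //; exists 0; rewrite /Q /= normr0.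
have int_shift z : mu.-integrable Q (EFin \o (fun u => Phi (z + u))).
  apply: measurable_bounded_integrable => //.
    apply: (@measurable_funS _ _ _ _ setT) => //.
    apply: (measurableT_comp mPhi).
    have := continuous_measurable_rV (@continuous_translation _ _ z).
    by congr (measurable_fun _ _); apply/funext => u; exact: addrC.
  exists B; split; first by rewrite num_real.
  by move=> M BM u _; apply: le_trans (ltW BM).
have gamUQ s u : - del <= s <= 1 + del -> Q u -> U (gam s + u).
  by move=> sI; rewrite /Q /= lt_min => /andP[ur _]; exact: gamU.
pose J s := \int[mu]_(u in Q) Phi (gam s + u).
have cJ : {within `[0, 1], continuous J}.
  apply: continuous_in_subspaceT => s; rewrite inE /= in_itv/= => s01.
  have sI : s \in (`]- del, 1 + del[%classic : set R).
    by rewrite inE /= in_itv/=; lra.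
  apply: (@continuity_under_integral R _ _ mu (fun s u => Phi (gam s + u)) Q mQ
    (- del) (1 + del) _ _ (cst B) _ _ s sI).
  - by move=> k _; exact: int_shift.
  - apply: aeW => u Qu k; rewrite inE /= in_itv/= => kI.
    have Uk : U (gam k + u) by apply: gamUQ => //; lra.
    apply: (@continuous_comp _ _ _ (fun l => gam l + u) Phi).
      apply: cvgD; last exact: cvg_cst.
      by apply: cvgD; [exact: cvg_cst|exact: scalel_continuous].
    apply/continuous_normP => e e0.
    have [r1 r10 P1] := nearU _ Uk.
    have [r2 r20 P2] := (continuous_normP _ _).1 (cphi _ Uk) _ e0.
    exists (Num.min r1 r2) => [|w]; first by rewrite lt_min r10.
    rewrite lt_min => /andP[w1 w2]; rewrite !PhiE//; first exact: P2.
    by rewrite -(subrK (gam k + u) w) addrC; exact: P1.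
  - apply: measurable_bounded_integrable => //.
    by exists B; split; rewrite ?num_real// => M BM u _ /=; rewrite ger0_norm// ltW.
  - by move=> k _; apply: aeW => u _; exact: PhiB.
have Jdiff s e rho : 0 < s < 1 -> 0 < e -> 0 < rho -> exists2 h, 0 < h < rho &
    - (e * h ^+ 2) <= J (s + h) + J (s - h) - 2 * J s.
  move=> s01 e0 rho0.
  (* This keeps [h n] below [rho], and [s + h n] and [s - h n] inside the prolonged interval. *)
  pose k := Num.min (rho / 2) del.
  have k0 : 0 < k by rewrite lt_min del0 divr_gt0.
  pose h (n : nat) := k / n.+1%:R.
  have h0 n : 0 < h n by rewrite divr_gt0.
  have hk n : h n <= k by rewrite ler_pdivrMr// ler_peMr ?(ltW k0)// ler1n.
  have hdel n : h n <= del by rewrite (le_trans (hk n))// ge_min lexx orbT.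
  have hrho n : h n < rho.
    rewrite (le_lt_trans (hk n))// (@le_lt_trans _ _ (rho / 2))//; last by lra.
    by rewrite ge_min lexx.
  have gamD l : gam (s + l) = gam s + l *: v by rewrite /gam scalerDl addrA.
  pose g n u := (Phi (gam (s + h n) + u) + Phi (gam (s - h n) + u) -
    2 * Phi (gam s + u)) * (h n ^- 2).
  have ig1 n : mu.-integrable Q (EFin \o (fun u => Phi (gam (s + h n) + u) +
      Phi (gam (s - h n) + u))).
    have := integrableD mQ (int_shift (gam (s + h n))) (int_shift (gam (s - h n))).
    by apply: eq_integrable.
  have ig2 : mu.-integrable Q (EFin \o (fun u => 2 * Phi (gam s + u))).
    have := integrableZl mQ 2 (int_shift (gam s)).
    by apply: eq_integrable.
  have ig3 n : mu.-integrable Q (EFin \o (fun u => Phi (gam (s + h n) + u) +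
      Phi (gam (s - h n) + u) - 2 * Phi (gam s + u))).
    have := integrableB mQ (ig1 n) ig2.
    by apply: eq_integrable.
  have ig n : mu.-integrable Q (EFin \o g n).
    have := integrableZr mQ (h n ^- 2) (ig3 n).
    by apply: eq_integrable.
  have intg n : \int[mu]_(u in Q) g n u =
      (J (s + h n) + J (s - h n) - 2 * J s) * (h n ^- 2).
    by rewrite /g RintegralZr// RintegralB// RintegralD// RintegralZl.
  have h20 n : 0 < h n ^- 2 by rewrite invr_gt0 exprn_gt0.
  have gE n u : Q u -> g n u = (phi (gam s + u + h n *: v) +
      phi (gam s + u - h n *: v) - 2 * phi (gam s + u)) * (h n ^- 2).
    move=> Qu; rewrite /g !PhiE; do ?by apply: gamUQ => //; have := hdel n; have := h0 n; lra.
    by rewrite !gamD scaleNr !(addrAC _ u).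
  have gC n u : Q u -> - (C * sqnorm v) <= g n u.
    move=> Qu; rewrite gE// ler_pdivlMr ?exprn_gt0//.
    have := semi (gam s + u) (h n *: v).
    rewrite /sqnorm dotZl dotZr => H.
    apply: le_trans (H _ _ _); last 3 first.
    - by apply: gamUQ => //; lra.
    - by rewrite addrAC -gamD; apply: gamUQ => //; have := hdel n; have := h0 n; lra.
    - rewrite addrAC -scaleNr -gamD; apply: gamUQ => //.
      by have := hdel n; have := h0 n; lra.
    by rewrite expr2; lra.
  (* The exceptional [u] lie in a translate of the null set where [phi] is not locally affine;
     elsewhere second differences vanish once [h n *: v] is short enough. *)
  have g0 : {ae mu, forall u, Q u -> exists N, forall n, (N <= n)%N -> 0 <= g n u}.
    apply: (@negligibleS _ _ _ mu _ _ _ (negligible_shift (gam s) ae_aff)) => u.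
    apply: contra_not => /=; rewrite addrC => aff Qu.
    have Uz : U (gam s + u) by apply: gamUQ => //; lra.
    have [p [c0 /near_normP[rr rr0' pE]]] := aff Uz.
    have v1 : 0 < `|v| + 1 by rewrite ltr_wpDl.
    exists (Num.bound (k * (`|v| + 1) / rr)) => n bn.
    have hv : `|h n *: v| < rr.
      rewrite normrZ gtr0_norm// (@le_lt_trans _ _ (h n * (`|v| + 1)))//.
        by rewrite ler_pM2l// lerDl.
      have : k * (`|v| + 1) / rr < n.+1%:R.
        apply: (lt_le_trans (archi_boundP _)).
          by rewrite divr_ge0 ?(ltW rr0')// mulr_ge0// ltW.
        by rewrite ler_nat (leq_trans bn).
      by rewrite ltr_pdivrMr// => H; rewrite /h mulrAC ltr_pdivrMr// (mulrC rr).
    rewrite gE// mulr_ge0 ?(ltW (h20 n))// !pE.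
    - by rewrite !(dotDr, dotNr); lra.
    - by rewrite subrr normr0.
    - by rewrite addrAC subrr add0r normrN.
    - by rewrite addrAC subrr add0r.
  have [|n] := fatou_lower_bound mQ Qoo _ ig gC g0 e0.
    by rewrite mulr_ge0// sqnorm_ge0.
  rewrite intg ler_pdivlMr ?exprn_gt0// mulNr => hn.
  by exists (h n); rewrite // h0 hrho.
have := second_difference_convex cJ Jdiff s101.
apply/negP; rewrite -ltNge -subr_gt0.
have i0 : mu.-integrable Q (EFin \o (fun u => (1 - s1) * Phi (gam 0 + u))).
  by have := integrableZl mQ (1 - s1) (int_shift (gam 0)); apply: eq_integrable.
have i1 : mu.-integrable Q (EFin \o (fun u => s1 * Phi (gam 1 + u))).
  by have := integrableZl mQ s1 (int_shift (gam 1)); apply: eq_integrable.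
have i2 : mu.-integrable Q (EFin \o (fun u => (1 - s1) * Phi (gam 0 + u) +
    s1 * Phi (gam 1 + u))).
  by have := integrableD mQ i0 i1; apply: eq_integrable.
have E : J s1 - ((1 - s1) * J 0 + s1 * J 1) = \int[mu]_(u in Q)
    (Phi (gam s1 + u) - ((1 - s1) * Phi (gam 0 + u) + s1 * Phi (gam 1 + u))).
  by rewrite RintegralB// RintegralD// !RintegralZl.
rewrite E; apply: (@lt_le_trans _ _ (\int[mu]_(u in Q) cst eta u)).
  by rewrite Rintegral_cst// mulr_gt0.
apply: le_Rintegral => //.
- apply: measurable_bounded_integrable => //.
  exists eta; split; rewrite ?num_real// => M etaM u _ /=.
  by rewrite ger0_norm ltW.
- have := integrableB mQ (int_shift (gam s1)) i2.
  by apply: eq_integrable.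
move=> u Qu /=; have g0E : gam 0 = x by rewrite /gam scale0r addr0.
have g1E : gam 1 = y by rewrite /gam scale1r /v addrC subrK.
rewrite !PhiE; do ?by apply: gamUQ => //; lra.
move: (Qu); rewrite /Q /= !lt_min => /and4P[_ ux uy ug].
have := xr _ ux; have := yr _ uy; have := gr _ ug; rewrite g0E g1E !ler_norml.
move=> /andP[H1 _] /andP[_ H2] /andP[_ H3].
have H2' : s1 * (phi (y + u) - phi y) <= s1 * eta by rewrite ler_wpM2l//; lra.
have H3' : (1 - s1) * (phi (x + u) - phi x) <= (1 - s1) * eta.
  by rewrite ler_wpM2l//; lra.
by move: H1 H2' H3'; rewrite /eta; lra.
Qed.

End mollification.

(** * Convex sets and the convex case *)

Section convex_closure.
Variables (R : realType) (d : nat).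
Implicit Types (D U K : set 'rV[R]_d) (f : 'rV[R]_d -> R).

Lemma convex_function_segmentP D f : convex_function D f <->
  forall x y s, D x -> D y -> 0 <= s <= 1 ->
    f (x + s *: (y - x)) <= (1 - s) * f x + s * f y.
Proof.
have E (x y : 'rV[R]_d) s : s *: y + (1 - s) *: x = x + s *: (y - x).
  by apply/rowP => i; rewrite !mxE; ring.
split=> [cf x y s Dx Dy /andP[s0 s1]|cf t x y /set_mem Dx /set_mem Dy].
  rewrite -E [leRHS]addrC; exact: cf (Itv01 s0 s1) y x (mem_set Dy) (mem_set Dx).
have t01 : 0 <= t%:num <= 1 by rewrite ge0 le1.
by have := cf y x _ Dy Dx t01; rewrite -E [leRHS]addrC.
Qed.

Lemma closure_normP U x :
  closure U x <-> forall e, 0 < e -> exists2 y, U y & `|y - x| < e.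
Proof.
split=> [Ux e e0|Ux B /near_normP[e e0 xB]].
  have [|y [Uy yx]] := Ux [set y | `|y - x| < e]; first by apply/near_normP; exists e.
  by exists y.
by have [y Uy yx] := Ux e e0; exists y; split => //; exact: xB.
Qed.

Lemma closure_norm_le U M : (forall x, U x -> `|x| <= M) ->
  forall x, closure U x -> `|x| <= M.
Proof.
move=> UM x /closure_normP Ux; apply/ler_addgt0Pr => e /Ux[y Uy yx].
rewrite -(subrK y x) addrC (le_trans (ler_normD _ _))// lerD ?UM//.
by rewrite distrC ltW.
Qed.

Lemma segment_dist (x y x' y' : 'rV[R]_d) s e : 0 <= s <= 1 ->
  `|x' - x| < e -> `|y' - y| < e ->
  `|(x' + s *: (y' - x')) - (x + s *: (y - x))| <= e.
Proof.
move=> /andP[s0 s1] /ltW xe /ltW ye.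
have -> : (x' + s *: (y' - x')) - (x + s *: (y - x)) =
    (1 - s) *: (x' - x) + s *: (y' - y).
  by apply/rowP => i; rewrite !mxE; ring.
rewrite (le_trans (ler_normD _ _))// !normrZ ger0_norm ?subr_ge0// ger0_norm//.
have : (1 - s) * `|x' - x| <= (1 - s) * e by rewrite ler_wpM2l// subr_ge0.
have : s * `|y' - y| <= s * e by rewrite ler_wpM2l.
by lra.
Qed.

Lemma closure_segment U : convex_set U -> forall x y s,
  closure U x -> closure U y -> 0 <= s <= 1 -> closure U (x + s *: (y - x)).
Proof.
move=> cU x y s /closure_normP Ux /closure_normP Uy s01.
apply/closure_normP => e e0; have e20 : 0 < e / 2 by rewrite divr_gt0.
have [x' Ux' x'x] := Ux _ e20; have [y' Uy' y'y] := Uy _ e20.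
exists (x' + s *: (y' - x')); first exact: convex_set_segment.
by rewrite (le_lt_trans (segment_dist s01 x'x y'y))//; lra.
Qed.

Lemma convex_function_closure U f : convex_set U ->
  {within closure U, continuous f} ->
  (forall x y s, U x -> U y -> 0 <= s <= 1 ->
    f (x + s *: (y - x)) <= (1 - s) * f x + s * f y) ->
  forall x y s, closure U x -> closure U y -> 0 <= s <= 1 ->
    f (x + s *: (y - x)) <= (1 - s) * f x + s * f y.
Proof.
move=> cU /within_continuous_normP cf fU x y s Ux Uy s01.
apply/ler_addgt0Pr => e e0; have e20 : 0 < e / 2 by rewrite divr_gt0.
have [r1 r10 P1] := cf x Ux _ e20.
have [r2 r20 P2] := cf y Uy _ e20.
have [r3 r30 P3] := cf _ (closure_segment cU Ux Uy s01) _ e20.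
(* Half of [r3], because [segment_dist] has a weak conclusion while [P3] needs a strict one. *)
pose r := Num.min r1 (Num.min r2 (r3 / 2)).
have r0 : 0 < r by rewrite !lt_min r10 r20 divr_gt0.
have [x' Ux' x'x] := (closure_normP _ _).1 Ux _ r0.
have [y' Uy' y'y] := (closure_normP _ _).1 Uy _ r0.
have sub := @subset_closure _ U.
have r3' : r < r3.
  apply: (@le_lt_trans _ _ (r3 / 2)); last by lra.
  by rewrite !ge_min lexx !orbT.
have := P3 _ (sub _ (convex_set_segment cU Ux' Uy' s01))
  (le_lt_trans (segment_dist s01 x'x y'y) r3').
have := fU _ _ _ Ux' Uy' s01.
move: x'x y'y; rewrite !lt_min => /and3P[x1 _ _] /and3P[_ y2 _].
have := P1 _ (sub _ Ux') x1; have := P2 _ (sub _ Uy') y2.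
rewrite !ler_norml => /andP[_ H2] /andP[_ H1] H /andP[H3 _].
have : s * (f y' - f y) <= s * (e / 2) by rewrite ler_wpM2l//; lra.
have : (1 - s) * (f x' - f x) <= (1 - s) * (e / 2) by rewrite ler_wpM2l//; lra.
by lra.
Qed.

(** A point [y1] slightly beyond [y] as seen from [x0] is approximated by some [w] in [U];
    displacing [x0] by the error [y1 - w] divided by [k] puts [y] on a segment joining two points of
    [U]. *)
Lemma interior_closure_convex U : open U -> convex_set U -> U !=set0 ->
  forall y, (\forall z \near y, closure U z) -> U y.
Proof.
move=> oU cU [x0 Ux0] y /near_normP[e e0 yU].
have /near_normP[r r0 x0U] : nbhs x0 U by exact: open_nbhs_nbhs.
pose k := e / (`|y - x0| + 1).
have v1 : 0 < `|y - x0| + 1 by rewrite ltr_wpDl.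
have k0 : 0 < k by rewrite divr_gt0.
pose y1 := y + k *: (y - x0).
have /closure_normP/(_ (k * r)) : closure U y1.
  apply: yU; rewrite addrAC subrr add0r normrZ gtr0_norm//.
  by rewrite /k mulrAC ltr_pdivrMr// ltr_pM2l// ltrDl.
case=> [|w Uw wy]; first by rewrite mulr_gt0.
have Ux : U (x0 + k^-1 *: (y1 - w)).
  apply: x0U; rewrite addrAC subrr add0r normrZ gtr0_norm ?invr_gt0// distrC.
  by rewrite mulrC ltr_pdivrMr// mulrC.
have k01 : 0 <= k / (1 + k) <= 1.
  have k10 : 0 < 1 + k by rewrite addr_gt0.
  by rewrite (divr_ge0 (ltW k0) (ltW k10))/= ler_pdivrMr// mul1r lerDr.
have := convex_set_segment cU Uw Ux k01; congr (U _).
apply/rowP => i; rewrite /y1 !mxE; field.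
by apply/andP; split; rewrite gt_eqF//; lra.
Qed.

Lemma sqnorm_continuous : continuous (@sqnorm R d).
Proof.
have -> : @sqnorm R d = fun x => \sum_(i < d) x 0 i * x 0 i by [].
apply: continuous_big => [|i _ z]; first exact: add_continuous.
by apply: (@continuousM R); exact: coord_continuous.
Qed.

Lemma sqnormB (x y : 'rV[R]_d) s :
  sqnorm (x - s *: y) = sqnorm x - s * (2 * dot x y - s * sqnorm y).
Proof. by rewrite /sqnorm !dotE (dotC y x); ring. Qed.

(** The functional is [y - z0] for the Euclidean nearest point [z0] of [K]: were it larger at some
    [z] in [K], a small step from [z0] towards [z] would come closer to [y]. *)
Lemma separating_functional K y : K !=set0 -> compact K ->
  (forall x z s, K x -> K z -> 0 <= s <= 1 -> K (x + s *: (z - x))) ->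
  ~ K y -> exists u M, (forall z, K z -> dot u z <= M) /\ M < dot u y.
Proof.
move=> K0 cK sK nKy.
have csq : continuous (fun z : 'rV[R]_d => sqnorm (y - z)).
  have -> : (fun z : 'rV[R]_d => sqnorm (y - z)) =
      (fun z => sqnorm y - 2 * dot y z + sqnorm z).
    by apply/funext => z; rewrite /sqnorm !dotE (dotC z y); ring.
  move=> z; apply: (@continuousD R R^o _ (fun z => sqnorm y - 2 * dot y z));
    last exact: sqnorm_continuous.
  apply: (@continuousB R R^o _ (cst (sqnorm y)) (fun z => 2 * dot y z)).
    exact: cst_continuous.
  apply: (@continuousM R _ (cst 2) (dot y)); first exact: cst_continuous.
  exact: dot_continuousr.
have [z0 /set_mem Kz0 z0min] :=
  compact_EVT_min K0 cK (continuous_subspaceT csq).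
pose u := y - z0.
have u0 : u != 0 by rewrite subr_eq0; apply/eqP => yz; apply: nKy; rewrite yz.
exists u, (dot u z0); split=> [z Kz|]; last first.
  by rewrite -subr_gt0 -dotBr; exact: sqnorm_gt0.
rewrite -subr_le0 -dotBr leNgt; apply/negP => uz.
(* The step is at most 1 to stay in [K], and short enough for the linear gain to beat the quadratic
   loss; the [+ 1] keeps the denominator positive. *)
pose w := z - z0; pose s := Num.min 1 (dot u w / (sqnorm w + 1)).
have w1 : 0 < sqnorm w + 1 by rewrite ltr_wpDl// sqnorm_ge0.
have s0 : 0 < s by rewrite lt_min ltr01 divr_gt0.
have s1 : 0 <= s <= 1 by rewrite ltW//= ge_min lexx.
have := z0min _ (mem_set (sK _ _ _ Kz0 Kz s1)).
have -> : sqnorm (y - (z0 + s *: (z - z0))) =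
    sqnorm u - s * (2 * dot u w - s * sqnorm w).
  by rewrite opprD addrA -/u -/w sqnormB.
rewrite -/u lerBrDr gerDl leNgt => /negP; apply.
rewrite mulr_gt0// subr_gt0.
have : s * sqnorm w <= dot u w.
  apply: (@le_trans _ _ (s * (sqnorm w + 1))); first by rewrite ler_wpM2l ?(ltW s0)// lerDl.
  by rewrite -ler_pdivlMr// ge_min lexx orbT.
by rewrite -/w in uz; lra.
Qed.

End convex_closure.

(** * Absolute continuity for convex [phi] *)

Section convex_case.
Variables (R : realType) (d : nat).
Local Notation mu := (@lebesgue_rV R d).
Implicit Types (U K : set 'rV[R]_d) (c phi : 'rV[R]_d -> R).

(** Covers an empty [Omega], for which the first transform is [-oo] everywhere. *)
Lemma convexification_set0 c y : convexification (extend_pinfty set0 c) y = +oo%E.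
Proof.
have E x : legendre (extend_pinfty set0 c) x = -oo%E.
  apply/eqP; rewrite eq_le leNye andbT; apply: ge_ereal_sup => _ [z _ <-].
  by rewrite /extend_pinfty in_set0.
apply/eqP; rewrite eq_le leey/=; apply: ereal_sup_ubound; exists 0 => //.
by rewrite E.
Qed.

(** For slopes [s *: u] along a separating functional, the affine minorants grow without bound at
    [y] as [s] increases. *)
Lemma convexification_notin K c y : K !=set0 -> compact K ->
  {within K, continuous c} ->
  (forall x z s, K x -> K z -> 0 <= s <= 1 -> K (x + s *: (z - x))) ->
  ~ K y -> convexification (extend_pinfty K c) y = +oo%E.
Proof.
move=> K0 cK cc sK nKy.
have [u [M [uM My]]] := separating_functional K0 cK sK nKy.
have [w _ wmin] := compact_EVT_min K0 cK cc.
apply/eqyP => A A0; pose s := Num.max 0 ((A - c w) / (dot u y - M)).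
have yM0 : 0 < dot u y - M by rewrite subr_gt0.
have s0 : 0 <= s by rewrite le_max lexx.
apply: le_trans (convexification_ge K0 cK cc y (s *: u)); rewrite lee_fin.
have [z [Kz -> _]] := compact_conjugate_max K0 cK cc (s *: u).
have : s * dot u z <= s * M by rewrite ler_wpM2l// uM.
have : c w <= c z by apply: wmin; exact: mem_set.
have : A - c w <= s * (dot u y - M).
  by rewrite -ler_pdivrMr// le_max lexx orbT.
by rewrite dotZl dotZr (dotC y u); lra.
Qed.

(** A countable family, so that the null sets found on each member can be united. *)
Definition rational_ball (t : 'rV[rat]_d * nat) : set 'rV[R]_d :=
  [set y | `|y - map_mx ratr t.1| <= t.2.+1%:R^-1].

Lemma rational_ball_basis U x : open U -> U x ->
  exists t, rational_ball t x /\ rational_ball t `<=` U.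
Proof.
move=> oU Ux.
have /near_normP[e e0 xU] : nbhs x U by exact: open_nbhs_nbhs.
pose n := Num.bound (2 / e); pose s : R := n.+1%:R^-1.
have s0 : 0 < s by rewrite invr_gt0.
have se : s + s < e.
  rewrite -mulr2n -mulr_natl /s ltr_pdivrMr// mulrC -ltr_pdivrMr//.
  apply: (lt_le_trans (archi_boundP _)); first by rewrite divr_ge0// ltW.
  by rewrite ler_nat.
have /choice[q qx] i : exists q : rat, ratr q \in `](x 0 i - s)%R, x 0%R i[.
  by apply: rat_in_itvoo; rewrite ltrBlDr ltrDl.
have near : `|x - map_mx ratr (\row_i q i)| <= s.
  apply: norm_le_coord => [|i]; first exact: ltW.
  have := qx i; rewrite !mxE in_itv/= => /andP[? ?].
  by rewrite ler_norml; lra.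
exists (\row_i q i, n); split => // y yt; apply: xU.
rewrite -(subrKA (map_mx ratr (\row_i q i))) (le_lt_trans (ler_normD _ _))//.
by rewrite (le_lt_trans _ se)// lerD// distrC.
Qed.

(** Convexity makes the local slope [p] support [phi] on all of [K]; adding the quadratic term,
    [y + p] supports [c] at [y]. *)
Lemma convexification_locally_affine K phi p (b : R) y :
  K !=set0 -> compact K -> {within K, continuous phi} ->
  (forall x z s, K x -> K z -> 0 <= s <= 1 ->
    phi (x + s *: (z - x)) <= (1 - s) * phi x + s * phi z) ->
  let c := fun z => 2^-1 * sqnorm z + phi z in
  {within K, continuous c} ->
  K y -> (\forall z \near y, phi z = dot p z + b) ->
  convexification (extend_pinfty K c) y = (c y)%:E.
Proof.
move=> K0 cK cphi convphi c cc Ky phiE.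
have phi_ge z : K z -> phi y + dot p (z - y) <= phi z.
  move=> Kz; have /near_normP[r r0 yr] := phiE.
  have v1 : 0 < `|z - y| + 1 by rewrite ltr_wpDl.
  (* Shrinking by [s] brings [z] into the ball around [y] where [phi] is affine. *)
  pose s := Num.min 1 (r / (`|z - y| + 1)).
  have s0 : 0 < s by rewrite lt_min ltr01 divr_gt0.
  have s1 : s <= 1 by rewrite ge_min lexx.
  have := convphi y z s Ky Kz; rewrite (ltW s0) s1 => /(_ isT).
  rewrite yr; last first.
    rewrite addrAC subrr add0r normrZ gtr0_norm//.
    rewrite (@lt_le_trans _ _ (s * (`|z - y| + 1)))//; first by rewrite ltr_pM2l// ltrDl.
    by rewrite -ler_pdivlMr// ge_min lexx orbT.
  rewrite (nbhs_singleton phiE) dotDr dotZr => H.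
  rewrite -subr_ge0 -(pmulr_rge0 _ s0); lra.
apply/eqP; rewrite eq_le convexification_le//=.
apply: le_trans (convexification_ge K0 cK cc y (y + p)); rewrite lee_fin.
have [z [Kz -> _]] := compact_conjugate_max K0 cK cc (y + p).
have := phi_ge z Kz.
have : 0 <= sqnorm (z - y) by exact: sqnorm_ge0.
by rewrite /c /sqnorm !dotE (dotC z y) (dotC y p); lra.
Qed.

(** On a ball where the gradient is [z + p], the preimage of a null set lies in a translate of it;
    countably many such balls cover almost all of [U]. *)
Lemma convex_gradient_absolutely_continuous U phi :
  open U -> convex_set U -> compact (closure U) ->
  {within closure U, continuous phi} ->
  let c := fun z => 2^-1 * sqnorm z + phi z in
  {within closure U, continuous c} ->
  (\forall x \ae mu, U x -> locally_affine_at phi x) ->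
  (forall x z s, closure U x -> closure U z -> 0 <= s <= 1 ->
    phi (x + s *: (z - x)) <= (1 - s) * phi x + s * phi z) ->
  gradient_pushforward (convexification (extend_pinfty (closure U) c)) `<< mu.
Proof.
move=> oU cU cK cphi c cc ae_aff convphi N nullN A mA AN.
have A0 : mu.-negligible A by apply/negligibleP => //; exact: nullN.
set f := convexification _.
apply: negligible_outer0.
pose S t := [set y | exists p, (forall z, rational_ball t z -> egradient f z = z + p) /\
  rational_ball t y /\ A (egradient f y)].
have S0 t : mu.-negligible (S t).
  have [[p pE]|nop] := pselect (exists p, forall z, rational_ball t z ->
      egradient f z = z + p); last first.
    apply: (@negligibleS _ _ _ mu set0); last exact: negligible_set0.
    by move=> y [p [pE _]]; apply: nop; exists p.
  apply: (@negligibleS _ _ _ mu _ _ _ (negligible_shift p A0)) => y.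
  by move=> [_ [_ [ty]]] /=; rewrite pE.
apply: (@negligibleS _ _ _ mu _ _ _
  (negligibleU ae_aff (negligible_bigcup_count S0))) => y [[fin_y dy] Ay].
have [aff|] := pselect (U y -> locally_affine_at phi y); [right|by left].
have U0 : U !=set0.
  apply/set0P/eqP => U0; have := nbhs_singleton fin_y.
  by rewrite /f U0 closure0 convexification_set0.
have K0 : closure U !=set0 by case: U0 => x Ux; exists x; exact: subset_closure.
(* [ediffble] includes finiteness near [y], and the convexification is infinite off the closure of
   [U]. *)
have Uy : U y.
  apply: (interior_closure_convex oU cU U0); apply: filterS fin_y => z.
  apply: contraPP => nKz; rewrite /f convexification_notin//.
  by move=> x w s; exact: closure_segment.
have [p [c0 affE]] := aff Uy.
pose V := [set z | U z /\ \forall w \near z, phi w = dot p w + c0].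
have oV : open V.
  rewrite openE => z [Uz az]; apply: filterI; first exact: open_nbhs_nbhs.
  exact: nbhs_interior.
have fV z : V z -> f z = (c z)%:E.
  move=> [Uz az]; apply: (convexification_locally_affine K0 cK cphi convphi cc _ az).
  exact: subset_closure.
have gradV z : V z -> egradient f z = z + p.
  move=> Vz; have [Uz az] := Vz.
  have [_ Df] : differentiable (fine \o f : 'rV[R]_d -> R^o) z /\
      forall v, 'D_v (fine \o f : 'rV[R]_d -> R^o) z = dot (z + p) v.
    apply: frechet_derivative => e e0.
    have /near_normP[r r0 zV] : nbhs z V by exact: open_nbhs_nbhs.
    have d1 : 0 < d%:R + 1 :> R by rewrite ltr_wpDl.
    (* The remainder is [2^-1 * sqnorm (w - z)]; the factor [d%:R + 1] again absorbs the one of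
       [dot_le_norm]. *)
    apply/near_normP; exists (Num.min r (e / (d%:R + 1))) => [|w].
      by rewrite lt_min r0 divr_gt0.
    rewrite lt_min => /andP[wr we].
    have Vw := zV w wr; have [_ aw] := Vw.
    rewrite /= !fV// /c /= (nbhs_singleton aw) (nbhs_singleton az).
    have -> : 2^-1 * sqnorm w + (dot p w + c0) - (2^-1 * sqnorm z + (dot p z + c0)) -
      dot (z + p) (w - z) = 2^-1 * dot (w - z) (w - z).
      by rewrite /sqnorm !dotE (dotC w z); lra.
    rewrite normrM ger0_norm ?invr_ge0//.
    have := dot_le_norm (w - z) (w - z).
    have : d%:R * `|w - z| * `|w - z| <= e * `|w - z|.
      rewrite ler_wpM2r//; apply: (@le_trans _ _ ((d%:R + 1) * `|w - z|)).
        by rewrite ler_wpM2r// lerDl.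
      by rewrite mulrC -ler_pdivlMr// ltW.
    have : 0 <= `|dot (w - z) (w - z)| by [].
    by lra.
  by apply/rowP => i; rewrite mxE Df dot_delta.
have [t [ty tV]] := rational_ball_basis oV (conj Uy affE).
exists t => //; exists p; split => // z tz.
by apply: gradV; exact: tV.
Qed.

End convex_case.

Unset Implicit Arguments.

Theorem theorem1p5 (R : realType) (d : nat) (Omega : set 'rV[R]_d)
    (phi : 'rV[R]_d -> R)
    (Omega_bounded : bounded_set Omega)
    (Omega_open : open Omega)
    (Omega_convex : convex_set Omega)
    (phi_continuous : {within closure Omega, continuous phi})
    (phi_locally_affine :
      \forall x \ae @lebesgue_rV R d, Omega x -> locally_affine_at phi x) :
  convex_function (closure Omega) phi <->
  exists2 t : R, 0 < t & kappa Omega phi t `<< @lebesgue_rV R d.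
Proof.
have cK : compact (closure Omega).
  apply: bounded_closed_compact; last exact: closed_closure.
  have [M M0 OM] := ex_strict_bound_gt0 Omega_bounded.
  exists M; split; first by rewrite num_real.
  move=> N MN x Kx; apply: le_trans (ltW MN).
  by apply: closure_norm_le Kx => y Oy; exact/ltW/OM.
have cpsi t : {within closure Omega,
    continuous (fun z => 2^-1 * sqnorm z + t * phi z)}.
  apply/subspace_continuousP => z Kz; apply: cvgD.
    apply: cvgMl_tmp; apply: cvg_within_filter; exact: sqnorm_continuous.
  by apply: cvgMl_tmp; exact: (subspace_continuousP _ _).1 phi_continuous z Kz.
split=> [/convex_function_segmentP convphi|[t t0 ac]].
  exists 1 => //; rewrite /kappa.
  rewrite (_ : psi Omega phi 1 = extend_pinfty (closure Omega)
      (fun z => 2^-1 * sqnorm z + phi z)); last first.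
    by apply/funext => z; rewrite /psi mul1r.
  apply: convex_gradient_absolutely_continuous => //.
  by have := cpsi 1; under eq_fun do rewrite mul1r.
apply/convex_function_segmentP; apply: convex_function_closure => //.
move=> x y s Ox Oy s01.
have K0 : closure Omega !=set0 by exists x; exact: subset_closure.
have slope := gradient_absolutely_continuous_subgradient K0 cK (cpsi t)
  Omega_open (@subset_closure _ Omega) ac.
have [B phiB] : exists B, forall z, Omega z -> `|phi z| <= B.
  have cn : {within closure Omega, continuous (fun z => `|phi z|)}.
    apply/subspace_continuousP => z Kz; apply: cvg_norm.
    exact: (subspace_continuousP _ _).1 phi_continuous z Kz.
  have [w _ wmax] := compact_EVT_max K0 cK cn.
  by exists `|phi w| => z Oz; apply: wmax; apply/mem_set/subset_closure.
apply: (convex_of_ae_affine Omega_open Omega_convex phiB _ phi_locally_affine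
  (C := t^-1)) => //.
- move=> z Oz; apply/continuous_normP => e e0.
  have [r1 r10 P1] := (within_continuous_normP _ _).1 phi_continuous z
    (subset_closure Oz) _ e0.
  have /near_normP[r2 r20 P2] : nbhs z Omega by exact: open_nbhs_nbhs.
  exists (Num.min r1 r2) => [|w]; first by rewrite lt_min r10.
  by rewrite lt_min => /andP[w1 w2]; apply: P1 => //; apply/subset_closure/P2.
- by rewrite invr_ge0 ltW.
(* Adding the supporting inequalities at [z + v] and [z - v] cancels [p], and the quadratic terms
   leave [sqnorm v]; dividing by [t] gives the constant [t^-1]. *)
move=> z v Oz Ozv Oznv; have [p pP] := slope z Oz.
have := pP _ (subset_closure Ozv); have := pP _ (subset_closure Oznv).
rewrite (addrAC z v) (addrAC z (- v)) subrr !add0r dotNr => H1 H2.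
rewrite -(ler_pM2l t0) mulrN mulrA divff ?gt_eqF// mul1r.
by move: H1 H2; rewrite /sqnorm !dotE (dotC v z); lra.
Qed.
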